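(* Let $(C_n)_{n\in\mathbb{N}}\subset(0,\infty)$ be such that $\sum_n C_n^{-1}<\infty$, and for each $n\in\mathbb{N}$ let $(x^n_i)_i$ be a normalized weakly null sequence in a Banach space $X$ (the same $X$ for all $n$) having spreading model $(\tilde x^n_i)_i$. Then there exists a seminormalized weakly null basic sequence $(y_i)$ in $X$ with spreading model $(\tilde y_i)$ such that $(\tilde y_i)$ $C_n$-dominates $(\tilde x^n_i)_i$ for all $n\in\mathbb{N}$, and such that moreover the following hold: (1) if for all $n\in\mathbb{N}$ the sequence $(\tilde x^n_i)_i$ is not equivalent to the unit vector basis of $\ell_1$, then $(\tilde y_i)$ is not equivalent to the unit vector basis of $\ell_1$; (2) if $(z_i)$ is a basic sequence which uniformly dominates the sequences $(\tilde x^n_i)_i$, $n\in\mathbb{N}$, then $(z_i)$ dominates $(\tilde y_i)$.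
   Context: Banach spaces are real. A sequence is seminormalized if its norms are bounded above and bounded away from $0$. A seminormalized sequence $(x_i)$ in a Banach space has (generates) the spreading model $(\tilde x_i)$, where $(\tilde x_i)$ is a basic sequence in some Banach space, if for some sequence $\varepsilon_n\searrow 0$ one has, for all $n\in\mathbb{N}$, all $(a_i)_{i=1}^n\in[-1,1]^n$ and all integers $n\le k_1<\dots<k_n$, $$\left|\Big\|\sum_{i=1}^n a_i x_{k_i}\Big\|-\Big\|\sum_{i=1}^n a_i\tilde x_i\Big\|\right|<\varepsilon_n .$$ Let $c_{00}$ denote the finitely supported real sequences. For basic sequences $(x_i),(y_i)$ and $C>0$, $(x_i)$ $C$-dominates $(y_i)$ if $C\|\sum a_ix_i\|\ge\|\sum a_iy_i\|$ for all $(a_i)\in c_{00}$; $(x_i)$ dominates $(y_i)$ if it $C$-dominates it for some $C\geq 1$. A basic sequence $(z_i)$ uniformly dominates the basic sequences $(x^n_i)_i$, $n\in\mathbb{N}$, if there is $C\ge1$ such that $(z_i)$ $C$-dominates $(x^n_i)_i$ for all $n\in\mathbb{N}$. *)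

(* Defs.v *)
From HB Require Import structures.
From mathcomp Require Import all_boot all_order all_algebra.
From mathcomp Require Import all_classical all_reals topology normedtype sequences.

Set Implicit Arguments.
Unset Strict Implicit.
Unset Printing Implicit Defensive.

Import Order.TTheory GRing.Theory Num.Theory.
Import numFieldNormedType.Exports.

Local Open Scope classical_set_scope.
Local Open Scope ring_scope.

(* Sequences are indexed from 0: the term x_i of the usual 1-based notation is
   [x i.-1].  A sum of a_i x_i over (a_i) in c_00 is [lin_comb n a x] for n
   large enough, so "for all (a_i) in c_00" is "for all n and all a". *)
Section sequences.
Variable R : realType.
Implicit Types X Y Z : normedModType R.

Definition lin_comb X (n : nat) (a : nat -> R) (x : nat -> X) : X :=
  \sum_(i < n) a i *: x i.

Definition closed_span X (x : nat -> X) : set X :=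
  closure [set v | exists n a, v = lin_comb n a x].

(* Schauder basis of its closed linear span. *)
Definition basic_sequence X (x : nat -> X) : Prop :=
  forall v, closed_span x v ->
    exists! a : nat -> R, series (fun i => a i *: x i) @ \oo --> v.

Definition normalized X (x : nat -> X) : Prop := forall i, `|x i| = 1.

Definition seminormalized X (x : nat -> X) : Prop :=
  exists c d : R, 0 < c /\ forall i, c <= `|x i| <= d.

Definition weakly_null X (x : nat -> X) : Prop :=
  forall f : {linear X -> R^o}, continuous f -> f \o x @ \oo --> (0 : R^o).

(* The successor in [n <= (k i).+1] accounts for the indexing from 0: the
   smallest admissible x_{k_1} is the n-th term of the sequence. *)
Definition has_spreading_model X Y (x : nat -> X) (xt : nat -> Y) : Prop :=
  [/\ seminormalized x, basic_sequence xt &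
    exists eps : nat -> R,
      [/\ nonincreasing_seq eps, eps @ \oo --> (0 : R) &
        forall (n : nat) (a : 'I_n -> R) (k : 'I_n -> nat),
          (forall i, -1 <= a i <= 1) ->
          (forall i, n <= (k i).+1)%N ->
          (forall i j : 'I_n, i < j -> k i < k j)%N ->
          `| `|\sum_(i < n) a i *: x (k i)| - `|\sum_(i < n) a i *: xt i| |
             < eps n]].

Definition dominates_with (C : R) X Y (x : nat -> X) (y : nat -> Y) : Prop :=
  forall n a, `|lin_comb n a y| <= C * `|lin_comb n a x|.

Definition dominates X Y (x : nat -> X) (y : nat -> Y) : Prop :=
  exists2 C : R, 1 <= C & dominates_with C x y.

Definition uniformly_dominates Z (Y : nat -> normedModType R)
    (z : nat -> Z) (x : forall n, nat -> Y n) : Prop :=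
  exists2 C : R, 1 <= C & forall n, dominates_with C z (x n).

Definition equivalent X Y (x : nat -> X) (y : nat -> Y) : Prop :=
  dominates x y /\ dominates y x.

End sequences.

Section ell1.
Variable R : realType.

Definition summable_seq : {pred (nat -> R)} :=
  fun x => `[< cvgn [normed series x] >].

Lemma summable_seqP (x : nat -> R) :
  reflect (cvgn [normed series x]) (x \in summable_seq).
Proof. exact: asboolP. Qed.

Lemma summable_seq0 : 0 \in summable_seq.
Proof.
apply/summable_seqP; rewrite (_ : [normed series _] = cst 0).
  exact: is_cvg_cst.
by apply/funext => n; rewrite /series/=; apply: big1 => i _; exact: normr0.
Qed.

Lemma summable_seqZD (c : R) : {in summable_seq &,
  forall x y : nat -> R, c *: x + y \in summable_seq}.
Proof.
move=> x y /summable_seqP cx /summable_seqP cy; apply/summable_seqP.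
have cxy : cvgn (series (`|c| *: (fun i => `|x i|) + fun i => `|y i|)).
  by apply: is_cvg_seriesD => //; exact: is_cvg_seriesZ.
apply: (series_le_cvg _ _ _ cxy) => i //=.
  by rewrite addr_ge0// mulr_ge0.
by apply: (le_trans (ler_normD _ _)); rewrite normrM.
Qed.

HB.instance Definition _ :=
  GRing.isSubmodClosed.Build R (nat -> R) summable_seq
    (GRing.submod_closed_semi (conj summable_seq0 summable_seqZD)).

(* Only the normed module structure is declared: completeness plays no role in
   the (mutual) domination of sequences. *)
Record ell1 := Ell1 { ell1_seq :> nat -> R; _ : ell1_seq \in summable_seq }.

HB.instance Definition _ := [isSub for ell1_seq].
HB.instance Definition _ := [Choice of ell1 by <:].
HB.instance Definition _ := [SubChoice_isSubLmodule of ell1 by <:].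

Lemma ell1_cvg (x : ell1) : cvgn [normed series x].
Proof. by apply/summable_seqP; case: x. Qed.

Definition ell1_norm (x : ell1) : R := limn [normed series x].

Lemma ell1_norm_ge (x : ell1) i : `|x i| <= ell1_norm x.
Proof.
have nd : nondecreasing_seq [normed series x].
  by apply: nondecreasing_series => j _ _; exact: normr_ge0.
have := nondecreasing_cvgn_le nd (@ell1_cvg x) i.+1; apply: le_trans.
by rewrite /= seriesSr lerDr; apply: sumr_ge0.
Qed.

Lemma ell1_normD x y : ell1_norm (x + y) <= ell1_norm x + ell1_norm y.
Proof.
rewrite /ell1_norm -lim_seriesD; [|exact: ell1_cvg..].
apply: lim_series_le; first exact: ell1_cvg.
  by apply: is_cvg_seriesD; exact: ell1_cvg.
by move=> n; exact: ler_normD.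
Qed.

Lemma ell1_normZ (c : R) x : ell1_norm (c *: x) = `|c| * ell1_norm x.
Proof.
rewrite /ell1_norm -[RHS]/(`|c| *: _) -lim_seriesZ; last exact: ell1_cvg.
by congr (limn (series _)); apply/funext => n; rewrite /= normrM.
Qed.

Lemma ell1_norm_eq0 x : ell1_norm x = 0 -> x = 0.
Proof.
move=> x0; apply/val_inj/funext => i /=; apply/normr0_eq0/le_anti.
by rewrite -{1}x0 ell1_norm_ge normr_ge0.
Qed.

HB.instance Definition _ :=
  Lmodule_isNormed.Build R ell1 ell1_normD ell1_normZ ell1_norm_eq0.

Lemma summable_seq_delta (i : nat) :
  (fun j => (j == i)%:R : R) \in summable_seq.
Proof.
apply/summable_seqP; rewrite -(is_cvg_series_restrict i.+1).
rewrite (_ : (fun n => _) = cst 0); first exact: is_cvg_cst.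
apply/funext => n; rewrite big_nat_cond big1// => j /andP[/andP[ij _] _].
by rewrite /= gtn_eqF//= normr0.
Qed.

Definition ell1_basis (i : nat) : ell1 := Ell1 (summable_seq_delta i).

End ell1.

(* Main.v *)
Require Import Defs.
From HB Require Import structures.
From mathcomp Require Import all_boot all_order all_algebra.
From mathcomp Require Import all_classical all_reals topology normedtype sequences.
From mathcomp Require Import lra.

Set Implicit Arguments.
Unset Strict Implicit.
Unset Printing Implicit Defensive.

Import Order.TTheory GRing.Theory Num.Theory.
Import numFieldNormedType.Exports.

Local Open Scope classical_set_scope.
Local Open Scope ring_scope.

(** Write c_m = 1 / C_m, a summable sequence of weights.  The sequence (y_i) is
    obtained by choosing suitable columns
      y_i = \sum_(m < M_i) c_m *: x^m_(k(i,m))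
    of the array of the given sequences, and everything rests on iterated limits
    along ultrafilters, which replace any appeal to Ramsey's theorem.

    Given an ultrafilter F on a set S and a bounded map Y : S -> X, the iterated
    limit
      N(a) = lim_(s_0 -> F) ... lim_(s_(n-1) -> F) |\sum_(i < n) a_i *: Y s_i|
    ([iter_norm]) exists with no extraction.  Along a free ultrafilter of indices
    of a sequence with a spreading model, N is the norm of that spreading model
    ([iter_norm_spreading_model]).  Conversely a diagonal argument produces points
    Y s_0, Y s_1, ... whose norms on combinations far out are as close to N as
    desired ([generic_sequence], [generic_sequence_spreads]), so that N is the norm
    of a spreading model of them.

    The ultrafilter used for (y_i) lives on finite tuples of indices and is the
    iterated product of a single free ultrafilter U on nat: its members are the
    sets containing, for U-most M, U-most k_0, ..., U-most k_(M-1), the tuple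
    (k_0, ..., k_(M-1)) ([column_filter]).  The three estimates are then:
    - [iter_norm_column_ge], the lower bound.  All functions v |-> N(a; v) arising
      from iterated limits are convex and 1-Lipschitz, hence weakly lower
      semicontinuous, so adding a term of a weakly null sequence cannot decrease
      them in the limit.  Dropping all rows but the n-th one from each column gives
      N(a) >= c_n |\sum a_i xt^n_i|, which is the domination with constant C_n.
    - [iter_norm_column_le], the upper bound.  By the triangle inequality
      N(a) <= \sum_(m < M) c_m |\sum a_i xt^m_i| + (\sum_(m >= M) c_m) \sum |a_i|.
      Letting M tend to infinity shows that any sequence dominating the (xt^n_i)
      with a common constant dominates (yt_i).
    - The estimate near ell_1.  If no (xt^m_i) is equivalent to the basis of ell_1,
      each of them is small on some vector of ell_1-norm 1.  As the norms are
      invariant under spreading, a tensor product of such vectors is simultaneously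
      small for all m < M ([common_small_combination]), and the upper bound makes N
      small there.

    The convexity used above takes the form of a duality statement
    ([iter_norm_dual]): ultralimits of norming functionals are norming for the
    iterated limits.  It reduces to the Hahn-Banach theorem for the norm of X, and it
    also realizes N as the norm of a sequence in a space ell_infty
    ([norm_lin_comb_coordinate]), which is the space carrying (yt_i). *)

(** * Limits along ultrafilters and the Hahn-Banach theorem *)

Section ultrafilters.

(** Deciding every set forces maximality, so an ultrafilter can be recognized
    without comparing it to other filters. *)
Lemma ultraP (T : Type) (F : set_system T) : ProperFilter F ->
  (forall A, F A \/ F (~` A)) -> UltraFilter F.
Proof.
move=> FF FA; split=> // G GG FG; apply/seteqP; split=> // A GA.
have [//|/FG GnA] := FA A.
have /filter_ex[t [] //] : G (A `&` ~` A) by exact: filterI.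
Qed.

Lemma filter_all_lt (T : Type) (F : set_system T) (P : nat -> set T) n :
  Filter F -> (forall m, (m < n)%N -> F (P m)) ->
  F [set t | forall m, (m < n)%N -> P m t].
Proof.
move=> FF; elim: n => [_|n IHn FP]; first exact: filterE.
have FPn := IHn (fun m mn => FP m (ltnW mn)).
apply: filterS (filterI FPn (FP n (ltnSn n))) => t [Pt Ptn] m.
by rewrite ltnS leq_eqVlt => /predU1P[->//|/Pt].
Qed.

Context {R : realType} {T : Type} (F : set_system T) {FU : UltraFilter F}.

Definition ulim (g : T -> R) : R := lim (g @ F).

Lemma ulim_cvg (g : T -> R) D : (forall s, `|g s| <= D) -> g @ F --> ulim g.
Proof.
move=> gD; have : (g @ F) `[- D, D]%classic.
  apply: (@filterE _ F) => s; rewrite /= in_itv/= -ler_norml; exact: gD.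
move=> /(segment_compact _)[p [_ clp]].
apply/cvg_ex; exists p => B pB.
have [//|FnB] := in_ultra_setVsetC (g @^-1` B) FU.
by have [r []] := clp (~` B) B FnB pB.
Qed.

Lemma ulim_unique (g : T -> R) l : g @ F --> l -> ulim g = l.
Proof. by move=> gl; apply/cvg_lim. Qed.

End ultrafilters.

Section norming_functional.
Context {R : realType} (X : lmodType R).
Implicit Types (q : X -> R).

(** Only one inequality is required for homogeneity: applied to c and to c^-1 it
    yields the equality ([sublinearZ]). *)
Definition sublinear q :=
  (forall u v, q (u + v) <= q u + q v) /\
  (forall c u, 0 < c -> q (c *: u) <= c * q u).

(** A bare predicate rather than a bundled linear map: the functionals below are
    obtained pointwise, as minimal sublinear functions or as ultralimits. *)
Definition linear_fun (f : X -> R) :=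
  forall a u v, f (a *: u + v) = a * f u + f v.

Lemma sublinear0 q : sublinear q -> q 0 = 0.
Proof.
move=> [_ qZ]; have := qZ 2 0; have := qZ 2^-1 0.
by rewrite !scaler0 => /(_ ltac:(lra)) + /(_ ltac:(lra)); lra.
Qed.

Lemma sublinear_ge q u : sublinear q -> - q (- u) <= q u.
Proof.
by move=> sq; have := sq.1 u (- u); rewrite subrr sublinear0//; lra.
Qed.

Lemma sublinearZ q c u : sublinear q -> 0 <= c -> q (c *: u) = c * q u.
Proof.
move=> sq; rewrite le_eqVlt => /predU1P[<-|c0].
  by rewrite scale0r mul0r sublinear0.
apply/eqP; rewrite eq_le sq.2//=.
have := sq.2 c^-1 (c *: u); rewrite invr_gt0 => /(_ c0).
by rewrite scalerA mulVf ?gt_eqF// scale1r ler_pdivlMl.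
Qed.

(** The largest sublinear function below q whose value at - x0 is at most - q x0.
    A minimal q must agree with it, hence be odd; and starting Zorn's lemma from it
    forces the functional obtained to take the value q x0 at x0. *)
Definition flatten_along q x0 u : R :=
  inf [set q (u + t *: x0) - t * q x0 | t in [set t | 0 <= t]].

Section flatten_along.
Variables (q : X -> R) (x0 : X) (sq : sublinear q).

(** Keeps the infimum finite. *)
Lemma flatten_along_lb u t : 0 <= t ->
  - q (- u) <= q (u + t *: x0) - t * q x0.
Proof.
move=> t0; rewrite -sublinearZ//.
have := sq.1 (u + t *: x0) (- u).
by rewrite addrAC subrr add0r; lra.
Qed.

Lemma flatten_along_le u t : 0 <= t ->
  flatten_along q x0 u <= q (u + t *: x0) - t * q x0.
Proof.
move=> t0; apply: ge_inf; last by exists t.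
by exists (- q (- u)) => _ [s s0 <-]; exact: flatten_along_lb.
Qed.

Lemma flatten_along_ge u r :
  (forall t, 0 <= t -> r <= q (u + t *: x0) - t * q x0) ->
  r <= flatten_along q x0 u.
Proof.
move=> H; apply: lb_le_inf; first by eexists; exists 0 => //=; exact: lexx.
by move=> _ [t t0 <-]; exact: H.
Qed.

Lemma flatten_along_sublinear : sublinear (flatten_along q x0).
Proof.
split=> [u v|c u c0].
  rewrite -lerBlDr; apply: flatten_along_ge => t t0.
  rewrite lerBlDl -lerBlDr; apply: flatten_along_ge => s s0.
  rewrite lerBlDl; apply: (le_trans (flatten_along_le (u + v) (addr_ge0 t0 s0))).
  have := sq.1 (u + t *: x0) (v + s *: x0).
  by rewrite addrACA -scalerDl mulrDl; lra.
rewrite -ler_pdivrMl//; apply: flatten_along_ge => t t0.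
rewrite ler_pdivrMl//.
apply: (le_trans (flatten_along_le (c *: u) (mulr_ge0 (ltW c0) t0))).
by rewrite -scalerA -scalerDr (sublinearZ _ sq (ltW c0)) mulrBr mulrA.
Qed.

Lemma flatten_along_le_self u : flatten_along q x0 u <= q u.
Proof.
by have := flatten_along_le u (lexx 0); rewrite scale0r addr0 mul0r subr0.
Qed.

Lemma flatten_along_opp : flatten_along q x0 (- x0) <= - q x0.
Proof.
have := flatten_along_le (- x0) ler01.
by rewrite scale1r addNr sublinear0// mul1r sub0r.
Qed.

End flatten_along.

(** Minimality against [flatten_along] gives q (- u) = - q u for all u, and an odd
    sublinear function is linear. *)
Lemma minimal_sublinear_linear q : sublinear q ->
  (forall q', sublinear q' -> (forall u, q' u <= q u) -> q' = q) ->
  linear_fun q.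
Proof.
move=> sq qmin.
have qN u : q (- u) = - q u.
  apply/eqP; rewrite eq_le; apply/andP; split.
    rewrite -[X in X (- u)](qmin (flatten_along q u)).
    - exact: flatten_along_opp.
    - exact: flatten_along_sublinear.
    - exact: flatten_along_le_self.
  by have := sublinear_ge u sq; lra.
have qZ c u : q (c *: u) = c * q u.
  have [c0|c0] := leP 0 c; first exact: sublinearZ.
  have := sublinearZ u sq (_ : 0 <= - c).
  by rewrite scaleNr qN => /(_ ltac:(lra)); lra.
move=> a u v; apply/eqP; rewrite eq_le -{1}qZ sq.1/=.
have := sq.1 (a *: u + v) (- v).
by rewrite addrK qN qZ; lra.
Qed.

(** The pointwise infimum of a chain stays sublinear because, of two members of
    the chain, the smaller one bounds q (u + v) by the sum of their values. *)
Lemma sublinear_chain_inf (p : X -> R) (A : set (X -> R)) : A !=set0 ->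
  (forall q, A q -> sublinear q /\ forall u, q u <= p u) ->
  (forall q1 q2, A q1 -> A q2 ->
    (forall u, q1 u <= q2 u) \/ (forall u, q2 u <= q1 u)) ->
  exists q, sublinear q /\ forall q', A q' -> forall u, q u <= q' u.
Proof.
move=> [q0 Aq0] AP Atot.
pose q u := inf [set q' u | q' in A].
have qle q' u : A q' -> q u <= q' u.
  move=> Aq'; apply: ge_inf; last by exists q'.
  exists (- p (- u)) => _ [r Ar <-]; have [sr rp] := AP _ Ar.
  by have := sublinear_ge u sr; have := rp (- u); lra.
have qge r u : (forall q', A q' -> r <= q' u) -> r <= q u.
  move=> H; apply: lb_le_inf; first by exists (q0 u), q0.
  by move=> _ [t At <-]; exact: H.
exists q; split; last by move=> q' Aq' u; exact: qle.
split=> [u v|c u c0].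
  rewrite -lerBlDr; apply: (qge _ _) => q1 Aq1; rewrite lerBlDl -lerBlDr.
  apply: (qge _ _) => q2 Aq2; rewrite lerBlDl.
  have [sq1 _] := AP _ Aq1; have [sq2 _] := AP _ Aq2.
  have [H|H] := Atot _ _ Aq1 Aq2.
    apply: (le_trans (qle _ (u + v) Aq1)); apply: (le_trans (sq1.1 _ _)).
    by rewrite lerD2l.
  apply: (le_trans (qle _ (u + v) Aq2)); apply: (le_trans (sq2.1 _ _)).
  by rewrite lerD2r.
rewrite -ler_pdivrMl//; apply: (qge _ _) => q1 Aq1; rewrite ler_pdivrMl//.
by apply: (le_trans (qle _ (c *: u) Aq1)); exact: (AP _ Aq1).1.2.
Qed.

(** The Hahn-Banach theorem: Zorn's lemma applied to all sublinear functions below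
    p, so that no partially defined functional is needed. *)
Lemma linear_le_sublinear (p : X -> R) : sublinear p ->
  exists f, linear_fun f /\ forall u, f u <= p u.
Proof.
move=> sp; pose P q := sublinear q /\ forall u, q u <= p u.
pose S := {q : X -> R | P q}.
pose below (s t : S) := `[< forall u, sval t u <= sval s u >].
have [||||[q [sq qp]] qmax] := @Zorn S below.
- by move=> t; apply/asboolP.
- move=> r s t /asboolP rs /asboolP st; apply/asboolP => u.
  exact: le_trans (st u) (rs u).
- move=> [s Ps] [t Pt] /asboolP/= st /asboolP/= ts.
  apply: eq_exist; apply/funext => u.
  by apply/eqP; rewrite eq_le st ts.
- move=> A Atot; have [[s As]|A0] := pselect (A !=set0); last first.
    by exists (exist _ p (conj sp (fun=> lexx _))) => s As; case: A0; exists s.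
  pose A' := [set sval s | s in A].
  have [|||q [sq qA]] := @sublinear_chain_inf p A'.
  + by exists (sval s), s.
  + by move=> _ [t At <-]; exact: svalP t.
  + move=> _ _ [t1 At1 <-] [t2 At2 <-].
    by have [/asboolP|/asboolP] := Atot _ _ At1 At2; [right|left].
  + have Pq : P q.
      split=> // u; apply: (le_trans (qA _ _ u)); first by exists s.
      exact: (svalP s).2.
    by exists (exist _ q Pq) => t At; apply/asboolP => u /=; apply: qA; exists t.
exists q; split=> //; apply: minimal_sublinear_linear => // q' sq' q'q.
have Pq' : P q' by split=> // u; exact: le_trans (q'q u) (qp u).
have /(_ _)/(congr1 sval) := qmax (exist _ q' Pq').
by apply; apply/asboolP.
Qed.

Lemma norming_functional (p : X -> R) v : sublinear p ->
  exists f, [/\ linear_fun f, forall u, f u <= p u & f v = p v].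
Proof.
move=> sp.
have [f [lf fp]] := linear_le_sublinear (flatten_along_sublinear v sp).
have fp' u : f u <= p u by apply: le_trans (fp u) (flatten_along_le_self _ _ _).
exists f; split=> //.
have f0 : f 0 = 0.
  by have := lf 1 0 0; rewrite scale1r addr0 mul1r; lra.
(* The flattened p bounds f at - v by - p v, which is the missing inequality at v. *)
have fN : f (- v) = - f v by have := lf (-1) v 0; rewrite scaleN1r !addr0 f0; lra.
have := fp (- v); have := flatten_along_opp v sp; have := fp' v.
by rewrite fN; lra.
Qed.

End norming_functional.

(** * Iterated limits of norms *)

Section limits.
Context {R : realType} {T : Type} (F : set_system T) {FF : ProperFilter F}.

Lemma cvg_le_lim (f g : T -> R) l l' : f @ F --> l -> g @ F --> l' ->
  (\forall s \near F, f s <= g s) -> l <= l'.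
Proof.
move=> fl gl fg; rewrite -subr_ge0.
apply: (cvgr_to_ge (cvgB gl fl)).
by apply: filterS fg => s fgs; rewrite /= subr_ge0.
Qed.

Lemma cvg_sum_ord (V : normedModType R) n (u : nat -> T -> V) (l : nat -> V) :
  (forall i, (i < n)%N -> u i @ F --> l i) ->
  (fun s => \sum_(i < n) u i s) @ F --> \sum_(i < n) l i.
Proof.
elim: n => [_|n IHn ul].
  rewrite big_ord0 (_ : (fun s => _) = cst 0); first exact: cvg_cst.
  by apply/funext => s; rewrite big_ord0.
rewrite big_ord_recr/= (_ : (fun s => _) = (fun s => \sum_(i < n) u i s) + u n).
  apply: cvgD; last exact: ul.
  by apply: IHn => i /ltnW; exact: ul.
by apply/funext => s; rewrite big_ord_recr.
Qed.

End limits.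

Section subdifferentiable.
Context {R : realType} {X : normedModType R}.

Lemma linear_fun0 (f : X -> R) : linear_fun f -> f 0 = 0.
Proof. by move=> lf; have := lf 1 0 0; rewrite scale1r addr0 mul1r; lra. Qed.

Lemma linear_funZ (f : X -> R) a u : linear_fun f -> f (a *: u) = a * f u.
Proof. by move=> lf; rewrite -[a *: u]addr0 lf linear_fun0// addr0. Qed.

Lemma linear_funD (f : X -> R) u v : linear_fun f -> f (u + v) = f u + f v.
Proof. by move=> lf; rewrite -[u]scale1r lf mul1r scale1r. Qed.

Lemma linear_funB (f : X -> R) u v : linear_fun f -> f (u - v) = f u - f v.
Proof.
by move=> lf; rewrite linear_funD// -scaleN1r linear_funZ// mulN1r.
Qed.

Lemma linear_fun_ler_norm (f : X -> R) : linear_fun f ->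
  (forall u, f u <= `|u|) -> forall u, `|f u| <= `|u|.
Proof.
move=> lf fle u; rewrite ler_norml fle andbT lerNl.
by have := fle (- u); rewrite normrN -scaleN1r linear_funZ// mulN1r.
Qed.

(** The form in which convexity and the 1-Lipschitz property of iterated limits are
    used: it passes to limits along ultrafilters. *)
Definition subdifferentiable (g : X -> R) := forall w, exists f,
  [/\ linear_fun f, forall u, `|f u| <= `|u| & forall u, g w + f u <= g (w + u)].

(** Weak lower semicontinuity: the subgradient at w sends the x_k to 0, hence g
    cannot drop in the limit when c x_k is added to w. *)
Lemma weakly_null_lsc (x : nat -> X) (g : X -> R) w c L :
  weakly_null x -> subdifferentiable g -> L < g w ->
  \forall k \near \oo, L < g (w + c *: x k).
Proof.
move=> x0 /(_ w)[f [lf fle fg]] Lg.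
pose M := GRing.isLinear.Build R X R^o _ (f : X -> R^o) lf.
pose h : {linear X -> R^o} := HB.pack (f : X -> R^o) M.
have hc : continuous h.
  apply/linear_bounded_continuous/linear_boundedP; exists 1; split=> // r r1 u.
  by apply: le_trans (fle u) _; rewrite ler_peMl// ltW.
have cf0 : (fun k => c * f (x k)) @ \oo --> (0 : R).
  by rewrite -(mulr0 c); apply: cvgMl_tmp; exact: (x0 h hc).
have gLw : 0 < g w - L by rewrite subr_gt0.
move/cvgr0Pnorm_lt : cf0 => /(_ _ gLw).
apply: filterS => k; rewrite ltr_norml => /andP[cfk _].
apply: lt_le_trans (fg _); rewrite linear_funZ//; lra.
Qed.

Lemma norm_sublinear : sublinear (fun u : X => `|u|).
Proof.
split=> [u v|c u c0]; first exact: ler_normD.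
by rewrite normrZ gtr0_norm.
Qed.

End subdifferentiable.

Section iter_norm.
Context {R : realType} {X : normedModType R} {T : Type} (F : set_system T).
Variable Y : T -> X.

Implicit Types (a b : nat -> R) (u v w : X).

(** The iterated limit lim_(s_0) ... lim_(s_(n-1)) |v + \sum_(i < n) a_i Y(s_i)|; the
    base point v is what makes the recursion on n possible. *)
Fixpoint iter_norm (n : nat) (a : nat -> R) (v : X) : R :=
  if n is m.+1 then
    ulim F (fun s => iter_norm m (fun i => a i.+1) (v + a 0%N *: Y s))
  else `|v|.

Lemma eq_iter_norm n a b v : (forall i, (i < n)%N -> a i = b i) ->
  iter_norm n a v = iter_norm n b v.
Proof.
elim: n a b v => //= n IHn a b v ab; congr ulim; apply/funext => s.
by rewrite ab//; apply: IHn => i ni; exact: ab.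
Qed.

Context {FU : UltraFilter F}.

Lemma iter_norm_eq0 n a v : (forall i, (i < n)%N -> a i = 0) ->
  iter_norm n a v = `|v|.
Proof.
elim: n a v => //= n IHn a v a0.
rewrite -[RHS](@ulim_unique _ _ F _ (cst `|v|)); last exact: cvg_cst.
congr ulim; apply/funext => s /=.
by rewrite a0// scale0r addr0 IHn// => i ni; exact: a0.
Qed.

Lemma iter_norm_pad n m a v : (forall i, (n <= i)%N -> a i = 0) ->
  (n <= m)%N -> iter_norm m a v = iter_norm n a v.
Proof.
elim: n m a v => [|n IHn] m a v a0 nm.
  by rewrite iter_norm_eq0// => i _; exact: a0.
case: m nm => //= m nm; congr ulim; apply/funext => s.
by apply: IHn => // i ni; exact: a0.
Qed.

Lemma iter_normN n a v : iter_norm n (fun i => - a i) (- v) = iter_norm n a v.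
Proof.
elim: n a v => [|n IHn] a v /=; first by rewrite normrN.
congr ulim; apply/funext => s.
by rewrite -[RHS]IHn; congr iter_norm; rewrite opprD scaleNr.
Qed.

Variable D : R.
Hypothesis YD : forall s, `|Y s| <= D.

(** This bound makes each of the successive limits exist. *)
Lemma iter_norm_bound n a v :
  `|iter_norm n a v| <= `|v| + D * \sum_(i < n) `|a i|.
Proof.
elim: n a v => [|n IHn] a v /=.
  by rewrite big_ord0 mulr0 addr0 normr_id.
set g := (fun s => _).
have gle s : `|g s| <= `|v| + D * \sum_(i < n.+1) `|a i|.
  apply: le_trans (IHn _ _) _; rewrite big_ord_recl/= mulrDr addrA lerD2r.
  apply: le_trans (ler_normD _ _) _; rewrite lerD2l normrZ mulrC.
  exact: ler_wpM2r.
have gc : `|g s| @[s --> F] --> `|ulim F g|.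
  by apply: cvg_norm; exact: ulim_cvg gle.
by apply: (cvgr_to_le gc); exact: filterE.
Qed.

Lemma iter_normS_cvg n a v :
  (fun s => iter_norm n (fun i => a i.+1) (v + a 0%N *: Y s)) @ F -->
  iter_norm n.+1 a v.
Proof.
apply: (@ulim_cvg _ _ _ _ _ (`|v| + D * \sum_(i < n.+1) `|a i|)) => s.
apply: le_trans (iter_norm_bound _ _ _) _.
rewrite big_ord_recl/= mulrDr addrA lerD2r.
apply: le_trans (ler_normD _ _) _; rewrite lerD2l normrZ mulrC.
exact: ler_wpM2r.
Qed.

(** The norming functional of an iterated limit is the ultralimit of norming
    functionals for the inner ones: f keeps track of the base point and t_i is the
    limit of the values of the functional on the i-th variable vector.  It says that
    (a, v) |-> iter_norm n a v is a supremum of linear functions, from which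
    subadditivity, the Lipschitz estimates and subgradients follow. *)
Lemma iter_norm_dual n a v : exists (f : X -> R) (t : nat -> R),
  [/\ linear_fun f, f v + \sum_(i < n) a i * t i = iter_norm n a v &
    forall b u, f u + \sum_(i < n) b i * t i <= iter_norm n b u].
Proof.
elim: n a v => [|n IHn] a v.
  have [f [lf fle fv]] := norming_functional v (@norm_sublinear R X).
  exists f, (fun=> 0); split=> //; first by rewrite big_ord0 addr0.
  by move=> b u; rewrite big_ord0 addr0 /=.
have /choice[h hP] : forall s, exists ft : (X -> R) * (nat -> R),
  [/\ linear_fun ft.1, ft.1 (v + a 0%N *: Y s) + \sum_(i < n) a i.+1 * ft.2 i =
      iter_norm n (fun i => a i.+1) (v + a 0%N *: Y s) &
    forall b u, ft.1 u + \sum_(i < n) b i * ft.2 i <= iter_norm n b u].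
  move=> s; have [f [t]] := IHn (fun i => a i.+1) (v + a 0%N *: Y s).
  by exists (f, t).
have hlin s : linear_fun (h s).1 by have [] := hP s.
have hle s u : `|(h s).1 u| <= `|u|.
  apply: linear_fun_ler_norm => {}u.
    by have [] := hP s.
  have [_ _ /(_ (fun=> 0) u)] := hP s.
  rewrite big1 ?addr0 => [|i _]; last by rewrite mul0r.
  by rewrite iter_norm_eq0.
have tle s i : (i < n)%N -> `|(h s).2 i| <= D.
  move=> ni; have [lf _ hb] := hP s.
  have H e : `|e| = 1 -> e * (h s).2 i <= D.
    move=> e1; have := hb (fun j => if j == i then e else 0) 0.
    rewrite linear_fun0// add0r (bigD1 (Ordinal ni))//= eqxx big1 ?addr0.
      move/le_trans; apply; apply: le_trans (ler_norm _) _.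
      apply: le_trans (iter_norm_bound _ _ _) _.
      rewrite normr0 add0r (bigD1 (Ordinal ni))//= eqxx e1 big1 ?addr0 ?mulr1//.
      by move=> j; rewrite -val_eqE/= => /negbTE ->; rewrite normr0.
    by move=> j; rewrite -val_eqE/= => /negbTE ->; rewrite mul0r.
  have := H 1; have := H (-1); rewrite normrN normr1 => /(_ erefl) + /(_ erefl).
  by rewrite ler_norml; lra.
(* The limits of the functionals obtained for each value of the first variable. *)
pose f u := ulim F (fun s => (h s).1 u).
pose t i := if i is j.+1 then ulim F (fun s => (h s).2 j)
            else ulim F (fun s => (h s).1 (Y s)).
have fc u : (fun s => (h s).1 u) @ F --> f u.
  by apply: ulim_cvg => s; exact: hle.
have t0c : (fun s => (h s).1 (Y s)) @ F --> t 0%N.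
  by apply: (@ulim_cvg _ _ _ _ _ D) => s; exact: le_trans (hle s _) (YD s).
have tc i : (i < n)%N -> (fun s => (h s).2 i) @ F --> t i.+1.
  by move=> ni; apply: (@ulim_cvg _ _ _ _ _ D) => s; exact: tle.
have key b u :
    (fun s => (h s).1 (u + b 0%N *: Y s) + \sum_(i < n) b i.+1 * (h s).2 i) @ F
    --> f u + \sum_(i < n.+1) b i * t i.
  rewrite big_ord_recl/= addrA; apply: cvgD.
    have -> : (fun s => (h s).1 (u + b 0%N *: Y s)) =
              (fun s => (h s).1 u) + (fun s => b 0%N * (h s).1 (Y s)).
      by apply/funext => s; rewrite linear_funD// linear_funZ.
    by apply: cvgD => //; exact: cvgMl_tmp.
  apply: (@cvg_sum_ord _ _ _ _ R n (fun i s => b i.+1 * (h s).2 i)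
    (fun i => b i.+1 * t i.+1)) => i ni.
  by apply: cvgMl_tmp; exact: tc.
exists f, t; split.
- move=> c u w; apply: (cvg_unique _ (fc (c *: u + w))) => //.
  have -> : (fun s => (h s).1 (c *: u + w)) =
      (fun s => c * (h s).1 u) + (fun s => (h s).1 w).
    by apply/funext => s; exact: (hlin s).
  by apply: cvgD => //; exact: cvgMl_tmp.
- apply: (cvg_unique _ (key a v)) => //.
  rewrite (_ : (fun s => _) =
    (fun s => iter_norm n (fun i => a i.+1) (v + a 0%N *: Y s))).
    exact: iter_normS_cvg.
  by apply/funext => s; have [_ ->] := hP s.
- move=> b u; apply: (cvg_le_lim (key b u) (@iter_normS_cvg n b u)).
  by apply: filterE => s; have [_ _] := hP s; exact.
Qed.

Lemma iter_norm_lipschitz n a b u w :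
  iter_norm n a u <= iter_norm n b w + `|u - w| +
    D * \sum_(i < n) `|a i - b i|.
Proof.
have [f [t [lf <- fle]]] := iter_norm_dual n a u.
have := lerD (fle b w) (fle (fun i => a i - b i) (u - w)).
rewrite linear_funB//; under [X in _ + _ + (_ + X) <= _]eq_bigr do rewrite mulrBl.
rewrite big_split/= sumrN.
have := iter_norm_bound n (fun i => a i - b i) (u - w).
rewrite ler_norml => /andP[_].
lra.
Qed.

Lemma iter_norm_dist n a b u w :
  `|iter_norm n a u - iter_norm n b w| <=
    `|u - w| + D * \sum_(i < n) `|a i - b i|.
Proof.
rewrite ler_norml; have := iter_norm_lipschitz n a b u w.
have := iter_norm_lipschitz n b a w u; rewrite (distrC w u).
under eq_bigr do rewrite distrC.
by move=> *; apply/andP; split; lra.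
Qed.

Lemma iter_norm_subdifferentiable n a : subdifferentiable (iter_norm n a).
Proof.
move=> w; have [f [t [lf <- fle]]] := iter_norm_dual n a w.
exists f; split=> //.
  apply: linear_fun_ler_norm => // u.
  have := fle (fun=> 0) u; rewrite iter_norm_eq0//.
  by rewrite big1 ?addr0// => i _; rewrite mul0r.
by move=> u; rewrite addrAC -linear_funD//; exact: fle.
Qed.

End iter_norm.

Arguments iter_normS_cvg {R X T F Y FU D} YD n a v [t] _.

Section compare.
Context {R : realType} {X : normedModType R} {S T : Type}.
Variables (F : set_system S) (G : set_system T) (Y : S -> X) (Z : T -> X).

(** The comparison of two families of vectors that survives iteration: one outermost
    limit along G is bounded below along F. *)
Definition lim_dominates := forall n (a : nat -> R) v L,
  L < iter_norm G Z n.+1 a v ->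
  \forall s \near F, L < iter_norm G Z n (fun i => a i.+1) (v + a 0%N *: Y s).

Context {FU : UltraFilter F}.
Variable D : R.
Hypothesis YD : forall s, `|Y s| <= D.

Lemma iter_norm_mono n a v : lim_dominates ->
  iter_norm G Z n a v <= iter_norm F Y n a v.
Proof.
move=> FG; elim: n a v => // n IHn a v.
rewrite leNgt; apply/negP => FG'.
have [L FL LG] : exists2 L, iter_norm F Y n.+1 a v < L &
    L < iter_norm G Z n.+1 a v.
  by eexists; [exact: (midf_lt FG').1|exact: (midf_lt FG').2].
suff : L <= iter_norm F Y n.+1 a v by lra.
apply: (cvgr_to_ge (iter_normS_cvg YD n a v)).
apply: filterS (FG _ _ _ _ LG) => s /ltW/le_trans; apply.
exact: IHn.
Qed.

End compare.

Section drop_tail.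
Context {R : realType} {X : normedModType R} {S : Type}.
Variables (F : set_system S) (Y : S -> X).
Context {FU : UltraFilter F}.
Variable D : R.
Hypotheses (YD : forall s, `|Y s| <= D).
Hypothesis Ylsc : forall v c L,
  L < `|v| -> \forall s \near F, L < `|v + c *: Y s|.

Lemma iter_norm_ge_norm n a v : `|v| <= iter_norm F Y n a v.
Proof.
have E m b u : iter_norm F (fun=> 0 : X) m b u = `|u|.
  elim: m b u => //= m IHm b u; rewrite scaler0 addr0 IHm.
  by apply: ulim_unique; exact: cvg_cst.
rewrite -(E n a v); apply: (iter_norm_mono YD) => m b u L.
rewrite E => Lu; apply: filterS (Ylsc (b 0%N) Lu) => s.
by rewrite E.
Qed.

(** By lower semicontinuity each suppressed limit is at least the value without its
    term.  This makes the canonical projections of the spreading model contractive. *)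
Lemma iter_norm_le_length n m a v : (n <= m)%N ->
  iter_norm F Y n a v <= iter_norm F Y m a v.
Proof.
elim: n m a v => [|n IHn] m a v nm; first exact: iter_norm_ge_norm.
case: m nm => // m; rewrite ltnS => nm.
apply: (cvg_le_lim (iter_normS_cvg YD n a v) (iter_normS_cvg YD m a v)).
by apply: filterE => s; exact: IHn.
Qed.

End drop_tail.

(** * The space ell_infty and a criterion for basic sequences *)

Section linfty.
Context {R : realType} {T : pointedType}.

Definition bounded_fun_pred : {pred (T -> R)} :=
  fun f => `[< exists M, forall t, `|f t| <= M >].

Lemma bounded_fun_predP (f : T -> R) :
  reflect (exists M, forall t, `|f t| <= M) (f \in bounded_fun_pred).
Proof. exact: asboolP. Qed.

Lemma bounded_fun_pred0 : 0 \in bounded_fun_pred.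
Proof. by apply/bounded_fun_predP; exists 0 => t; rewrite normr0. Qed.

Lemma bounded_fun_predZD (c : R) : {in bounded_fun_pred &,
  forall f g : T -> R, c *: f + g \in bounded_fun_pred}.
Proof.
move=> f g /bounded_fun_predP[M fM] /bounded_fun_predP[N gN].
apply/bounded_fun_predP; exists (`|c| * M + N) => t.
apply: (le_trans (ler_normD _ _)); rewrite lerD//.
by rewrite normrM ler_wpM2l.
Qed.

HB.instance Definition _ :=
  GRing.isSubmodClosed.Build R (T -> R) bounded_fun_pred
    (GRing.submod_closed_semi (conj bounded_fun_pred0 bounded_fun_predZD)).

Record linfty := Linfty {
  linfty_fun :> T -> R; _ : linfty_fun \in bounded_fun_pred }.

HB.instance Definition _ := [isSub for linfty_fun].
HB.instance Definition _ := [Choice of linfty by <:].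
HB.instance Definition _ := [SubChoice_isSubLmodule of linfty by <:].

Definition linfty_norm (f : linfty) : R := sup [set `|f t| | t in setT].

Lemma linfty_has_sup (f : linfty) : has_sup [set `|f t| | t in setT].
Proof.
split; first by exists `|f point|, point.
case: f => f /= /bounded_fun_predP[M fM].
by exists M => _ [t _ <-]; exact: fM.
Qed.

Lemma linfty_norm_ge (f : linfty) t : `|f t| <= linfty_norm f.
Proof.
by apply: sup_upper_bound; [exact: linfty_has_sup|exists t].
Qed.

Lemma linfty_norm_le (f : linfty) M :
  (forall t, `|f t| <= M) -> linfty_norm f <= M.
Proof.
move=> fM; apply: ge_sup => [|_ [t _ <-]//].
by exists `|f point|, point.
Qed.

Lemma linfty_normD (f g : linfty) :
  linfty_norm (f + g) <= linfty_norm f + linfty_norm g.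
Proof.
apply: linfty_norm_le => t; apply: (le_trans (ler_normD _ _)).
by rewrite lerD// linfty_norm_ge.
Qed.

Lemma linfty_normZ (c : R) (f : linfty) :
  linfty_norm (c *: f) = `|c| * linfty_norm f.
Proof.
have le c' (g : linfty) : linfty_norm (c' *: g) <= `|c'| * linfty_norm g.
  apply: linfty_norm_le => t; rewrite [X in `|X|]/(c' * g t) normrM.
  by rewrite ler_wpM2l// linfty_norm_ge.
apply/eqP; rewrite eq_le le/=.
have [->|c0] := eqVneq c 0.
  by rewrite normr0 mul0r; apply: le_trans (linfty_norm_ge _ point).
have := le c^-1 (c *: f); rewrite scalerA mulVf// scale1r normfV.
by rewrite ler_pdivlMl// normr_gt0.
Qed.

Lemma linfty_norm_eq0 (f : linfty) : linfty_norm f = 0 -> f = 0.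
Proof.
move=> f0; apply/val_inj/funext => t /=; apply/normr0_eq0/le_anti.
by rewrite -{1}f0 linfty_norm_ge normr_ge0.
Qed.

HB.instance Definition _ :=
  Lmodule_isNormed.Build R linfty linfty_normD linfty_normZ linfty_norm_eq0.

Lemma linfty_subE (f g : linfty) t : (f - g) t = f t - g t.
Proof. by []. Qed.

(** The pointwise limit of a Cauchy filter is uniform, since a ball of the sup
    norm is stable under pointwise limits. *)
Lemma linfty_complete (F : set_system linfty) :
  ProperFilter F -> cauchy F -> cvg F.
Proof.
move=> FF /cauchyP Fc.
have evc t : cvg ((fun f : linfty => f t) @ F).
  apply/cauchy_cvgP/cauchyP => e e0; have [f Ff] := Fc e e0.
  exists (f t); change (F (fun g : linfty => ball (f t) e (g t))).
  apply: (filterS _ Ff) => g; rewrite -ball_normE /= -ball_normE /=.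
  by apply: le_lt_trans; exact: (linfty_norm_ge (f - g)).
pose l t := lim ((fun f : linfty => f t) @ F).
have lf e (f : linfty) t : F (ball f e) -> `|f t - l t| <= e.
  move=> Ff; apply: (@cvgr_to_le _ F _ _ (fun g : linfty => `|f t - g t|)).
    by apply: cvg_norm; apply: cvgB; [exact: cvg_cst|exact: evc].
  apply: (filterS _ Ff) => g; rewrite -ball_normE /= => /ltW; apply: le_trans.
  exact: (linfty_norm_ge (f - g)).
have lb : l \in bounded_fun_pred.
  have [f Ff] := Fc 1 ltr01.
  apply/bounded_fun_predP; exists (1 + linfty_norm f) => t.
  rewrite -(subrK (f t) (l t)); apply: (le_trans (ler_normD _ _)).
  by rewrite distrC lerD ?lf ?linfty_norm_ge.
apply/cvg_ex; exists (Linfty lb).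
apply/cvgrPdist_le => e e0; have e20 : 0 < e / 2 by lra.
have [f Ff] := Fc _ e20.
apply: (filterS _ Ff) => g; rewrite -ball_normE /= => fg.
apply: linfty_norm_le => t.
have := lf _ _ t Ff; have := le_trans (linfty_norm_ge (f - g) t) (ltW fg).
by rewrite !linfty_subE/= !ler_norml => /andP[? ?] /andP[? ?]; apply/andP; split; lra.
Qed.

HB.instance Definition _ := Uniform_isComplete.Build linfty linfty_complete.

End linfty.
Arguments linfty : clear implicits.

Section grunblum.
Context {R : realType} {X : normedModType R}.
Implicit Types (x : nat -> X) (a b : nat -> R).

Lemma lin_combS n a x : lin_comb n.+1 a x = lin_comb n a x + a n *: x n.
Proof. by rewrite /lin_comb big_ord_recr. Qed.

Lemma lin_combB n a b x :
  lin_comb n (fun i => a i - b i) x = lin_comb n a x - lin_comb n b x.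
Proof.
by rewrite /lin_comb -sumrB; apply: eq_bigr => i _; rewrite scalerBl.
Qed.

Lemma lin_combZ n c a x :
  lin_comb n (fun i => c * a i) x = c *: lin_comb n a x.
Proof.
by rewrite /lin_comb scaler_sumr; apply: eq_bigr => i _; rewrite scalerA.
Qed.

Lemma eq_lin_comb n a b x : (forall i, (i < n)%N -> a i = b i) ->
  lin_comb n a x = lin_comb n b x.
Proof. by move=> ab; apply: eq_bigr => i _; rewrite ab. Qed.

Lemma lin_comb_pad n m a x : (n <= m)%N ->
  (forall i, (n <= i)%N -> a i = 0) -> lin_comb m a x = lin_comb n a x.
Proof.
move=> nm a0; rewrite -(subnKC nm); elim: (m - n)%N => [|k IHk].
  by rewrite addn0.
by rewrite addnS lin_combS IHk a0 ?leq_addr// scale0r addr0.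
Qed.

(** Turns combinations of different lengths into combinations of a common length. *)
Definition cut n a i : R := if (i < n)%N then a i else 0.

Lemma cut_ge n a i : (n <= i)%N -> cut n a i = 0.
Proof. by rewrite /cut ltnNge => ->. Qed.

Lemma cut_lt n a i : (i < n)%N -> cut n a i = a i.
Proof. by rewrite /cut => ->. Qed.

Lemma lin_comb_cut n m a x : (n <= m)%N ->
  lin_comb m (cut n a) x = lin_comb n a x.
Proof.
move=> nm; rewrite (lin_comb_pad _ nm); last by move=> i; exact: cut_ge.
by apply: eq_lin_comb => i; exact: cut_lt.
Qed.

Lemma series_lin_comb a x :
  series (fun i => a i *: x i) = (fun n => lin_comb n a x).
Proof. by apply/funext => n; rewrite /series/= big_mkord. Qed.

Lemma bounded_projections_coef x K :
  (forall m n a, (m <= n)%N -> `|lin_comb m a x| <= K * `|lin_comb n a x|) ->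
  forall n a i, (i < n)%N -> `|a i| * `|x i| <= (K + K) * `|lin_comb n a x|.
Proof.
move=> xK n a i ni; rewrite -normrZ.
rewrite (_ : a i *: x i = lin_comb i.+1 a x - lin_comb i a x); last first.
  by rewrite lin_combS addrAC subrr add0r.
by apply: (le_trans (ler_normB _ _)); rewrite mulrDl lerD// xK// ltnW.
Qed.

(** Grunblum's criterion.  A vector of the closed span is a limit of finite
    combinations; uniform boundedness of the partial-sum projections makes their
    coefficients converge, and makes the series with the limit coefficients converge
    to that very vector. *)
Lemma bounded_projections_basic x K : (forall i, x i != 0) ->
  (forall m n a, (m <= n)%N -> `|lin_comb m a x| <= K * `|lin_comb n a x|) ->
  basic_sequence x.
Proof.
move=> x0 xK v xv.
have xn0 i : 0 < `|x i| by rewrite normr_gt0.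
have coef := bounded_projections_coef xK.
have K0 : 0 <= K.
  have := xK 0%N 1%N (fun=> 1) isT.
  rewrite /lin_comb big_ord0 big_ord1 normr0 scale1r.
  by rewrite pmulr_lge0.
have /choice[na naP] : forall p, exists na : nat * (nat -> R),
    `|v - lin_comb na.1 na.2 x| < p.+1%:R^-1.
  move=> p; have : nbhs v (ball v (p.+1%:R^-1 : R)).
    by apply: nbhsx_ballx; rewrite invr_gt0.
  move=> /xv[_ [[n [a ->]]]]; rewrite -ball_normE /= => H.
  by exists (n, a).
pose N p := (na p).1; pose A p := cut (N p) (na p).2.
pose V p := lin_comb (N p) (A p) x.
have VE m p : (N p <= m)%N -> lin_comb m (A p) x = V p.
  by move=> Npm; rewrite /V !lin_comb_cut.
have Vv : V @ \oo --> v.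
  apply/cvgrPdist_lt => e e0.
  have : \forall p \near \oo, @harmonic R p < e.
    exact: (cvgr_lt _ cvg_harmonic).
  by apply: filterS => p; apply: lt_trans; rewrite /V lin_comb_cut//; exact: naP.
have AV p q m :
    `|lin_comb m (fun i => A p i - A q i) x| <= K * `|V p - V q|.
  pose M := maxn m (maxn (N p) (N q)).
  apply: (le_trans (xK _ M _ _)); first by rewrite leq_max leqnn.
  by rewrite lin_combB !VE// !leq_max leqnn !orbT.
have AVi p q i : `|A p i - A q i| * `|x i| <= (K + K) * `|V p - V q|.
  pose M := maxn i.+1 (maxn (N p) (N q)).
  have := coef M (fun i => A p i - A q i) i; rewrite lin_combB.
  by rewrite !VE ?leq_max ?leqnn ?orbT//; exact.
have Acvg i : cvg ((fun p => A p i) @ \oo).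
  apply/cauchy_cvgP/cauchyP => e e0.
  have e'0 : 0 < e * `|x i| / (K + K + 1) / 2.
    by rewrite divr_gt0// divr_gt0 ?mulr_gt0//; lra.
  move/cvgrPdist_lt : Vv => /(_ _ e'0)[p0 _ Hp0].
  exists (A p0 i); exists p0 => // p p0p; rewrite /= -ball_normE /=.
  rewrite -(ltr_pM2r (xn0 i)); apply: (le_lt_trans (AVi _ _ _)).
  have VV : `|V p0 - V p| < e * `|x i| / (K + K + 1).
    rewrite -(subrKA v); apply: (le_lt_trans (ler_normD _ _)).
    have := Hp0 p0 (leqnn p0); have := Hp0 p p0p; rewrite /= (distrC v (V p0)).
    by move: (_ / (K + K + 1)) => r; lra.
  have : (K + K + 1) * `|V p0 - V p| < e * `|x i|.
    by rewrite mulrC -ltr_pdivlMr//; lra.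
  by have := normr_ge0 (V p0 - V p); lra.
pose a i := lim ((fun p => A p i) @ \oo).
have Aa p m : `|lin_comb m (fun i => A p i - a i) x| <= K * `|V p - v|.
  apply: (@cvg_le_lim _ _ \oo _
    (fun q => `|lin_comb m (fun i => A p i - A q i) x|)
    (fun q => K * `|V p - V q|)).
  - apply: cvg_norm; rewrite /lin_comb.
    apply: (@cvg_sum_ord _ _ _ _ _ m (fun i q => (A p i - A q i) *: x i)
      (fun i => (A p i - a i) *: x i)) => i _.
    by apply: cvgZr_tmp; apply: cvgB; [exact: cvg_cst|exact: Acvg].
  - apply: cvgMl_tmp; apply: cvg_norm.
    by apply: cvgB; [exact: cvg_cst|exact: Vv].
  - by apply: filterE => q; exact: AV.
have va : (fun n => lin_comb n a x) @ \oo --> v.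
  apply/cvgrPdist_lt => e e0; have e'0 : 0 < e / (K + 1) by rewrite divr_gt0//; lra.
  move/cvgrPdist_lt : Vv => /(_ _ e'0)[p _ /(_ p (leqnn p))/= Vp].
  exists (N p) => // n Npn /=.
  rewrite -(subrKA (V p)); apply: (le_lt_trans (ler_normD _ _)).
  have := Aa p n; rewrite lin_combB VE// (distrC (V p) v).
  by move: Vp; rewrite ltr_pdivlMr; lra.
exists a; split; first by rewrite series_lin_comb.
move=> b; rewrite series_lin_comb => vb.
apply/funext => i; apply/eqP; rewrite -subr_eq0 -normr_eq0 eq_le normr_ge0 andbT.
rewrite -(pmulr_lle0 _ (xn0 i)).
apply: (@cvgr_to_ge _ \oo _ _
  (fun n => (K + K) * `|lin_comb n a x - lin_comb n b x|)).
  rewrite -(mulr0 (K + K)); apply: cvgMl_tmp; rewrite -(@normr0 _ X) -(subrr v).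
  by apply: cvg_norm; exact: cvgB.
exists i.+1 => // n /= ni; rewrite -lin_combB.
exact: (coef n (fun i => a i - b i) i).
Qed.

End grunblum.

(** * Columns of an array and their ultrafilter *)

Section product_ultrafilter.

Lemma ultra_fmap (S T : Type) (f : S -> T) (F : set_system S) :
  UltraFilter F -> UltraFilter (f @ F).
Proof.
move=> FU; apply: ultraP => A.
exact: (in_ultra_setVsetC (f @^-1` A) FU).
Qed.

(** The iterated (Fubini) product of filters. *)
Definition fbind (S T : Type) (F : set_system S) (G : S -> set_system T) :
  set_system T := [set A | F [set s | G s A]].

Lemma fbind_ultra (S T : Type) (F : set_system S) (G : S -> set_system T) :
  UltraFilter F -> (forall s, UltraFilter (G s)) -> UltraFilter (fbind F G).
Proof.
move=> FU GU; apply: ultraP => [|A].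
  apply: Build_ProperFilter_ex => [A|].
    move=> FA; have [s GA] : exists s, G s A by exact: (@filter_ex _ F).
    exact: filter_ex GA.
  split.
  - by rewrite /fbind /=; apply: filterE => s; exact: filterT.
  - move=> A B; rewrite /fbind /= => FA FB.
    by apply: filterS (filterI FA FB) => s [GA GB]; exact: filterI.
  - move=> A B AB; rewrite /fbind /= => FA.
    by apply: filterS FA => s; exact: filterS.
have [|FA] := in_ultra_setVsetC [set s | G s A] FU; [by left|right].
apply: filterS FA => s /= GA.
by have [] := in_ultra_setVsetC A (GU s).
Qed.

Variable U : set_system nat.
Context {UU : UltraFilter U}.

(** The M-fold Fubini power of U, whose outermost quantifier concerns the first entry
    of the tuple; growing tuples at their end lets the rows be treated inductively. *)
Fixpoint tuple_filter (M : nat) : set_system (seq nat) :=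
  if M is m.+1 then fbind (tuple_filter m) (fun s => rcons s @ U)
  else [set A | A [::]].

#[global] Instance tuple_filter_ultra M : UltraFilter (tuple_filter M).
Proof.
elim: M => [|M IHM] /=.
  apply: ultraP => [|A]; last exact: EM.
  apply: Build_ProperFilter_ex => [A A0|]; first by exists [::].
  by split=> //= A B AB; exact: AB.
by apply: fbind_ultra => s; exact: ultra_fmap.
Qed.

(** The number of rows is itself chosen along U, so that every fixed number of rows
    is eventually present. *)
Definition column_filter : set_system (seq nat) := fbind U tuple_filter.

#[global] Instance column_filter_ultra : UltraFilter column_filter.
Proof. exact: fbind_ultra. Qed.

Lemma tuple_filter_size M : tuple_filter M [set s | size s = M].
Proof.
elim: M => //= M IHM; apply: filterS IHM => s /= sM.
by apply: filterE => k; rewrite /= size_rcons sM.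
Qed.

Lemma tuple_filter_nth M m (P : set nat) : (m < M)%N -> U P ->
  tuple_filter M [set s | P (nth 0%N s m)].
Proof.
elim: M => // M IHM; rewrite ltnS leq_eqVlt => /predU1P[->|mM] UP /=.
  apply: filterS (tuple_filter_size M) => s /= sM.
  by apply: filterS UP => k; rewrite /= nth_rcons sM ltnn eqxx.
apply: filterS (filterI (IHM mM UP) (tuple_filter_size M)) => s /= [sP sM].
by apply: filterE => k; rewrite /= nth_rcons sM mM.
Qed.

Hypothesis Uoo : \oo `<=` U.

Lemma column_filter_size M : column_filter [set s | (M <= size s)%N].
Proof.
apply: (filterS _ (Uoo (nbhs_infty_ge M))) => N /= MN.
by apply: filterS (tuple_filter_size N) => s /= ->.
Qed.

(** Every coordinate of a tuple is distributed according to U, whatever the level at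
    which it is chosen. *)
Lemma column_filter_nth m (P : set nat) : U P ->
  column_filter [set s | P (nth 0%N s m)].
Proof.
move=> UP; apply: (filterS _ (Uoo (nbhs_infty_gt m))) => N /= mN.
exact: tuple_filter_nth.
Qed.

Lemma column_filter_from n (P : set (seq nat)) :
  (forall M, (n <= M)%N -> tuple_filter M P) -> column_filter P.
Proof. by move=> H; exact: (filterS _ (Uoo (nbhs_infty_ge n))). Qed.

End product_ultrafilter.

Section columns.
Context {R : realType} {X : normedModType R}.
Variables (c : nat -> R) (x : nat -> nat -> X) (D : R).
Hypotheses (c0 : forall n, 0 < c n) (cD : forall n, \sum_(m < n) c m <= D).
Hypotheses (x1 : forall n, normalized (x n)).

Definition column (s : seq nat) : X :=
  \sum_(m < size s) c m *: x m (nth 0%N s m).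

Lemma column_rcons s k :
  column (rcons s k) = column s + c (size s) *: x (size s) k.
Proof.
rewrite /column size_rcons big_ord_recr/= nth_rcons ltnn eqxx; congr (_ + _).
by apply: eq_bigr => i _; rewrite nth_rcons ltn_ord.
Qed.

Lemma norm_column_sub_head M s : (M <= size s)%N ->
  `|column s - \sum_(m < M) c m *: x m (nth 0%N s m)| <=
  D - \sum_(m < M) c m.
Proof.
rewrite /column => Ms; set z := fun m => c m *: x m (nth 0%N s m).
rewrite -(big_mkord xpredT z) -(big_mkord xpredT z) (big_cat_nat _ Ms)//= addrAC.
rewrite subrr add0r; apply: (le_trans (ler_norm_sum _ _ _)).
apply: (@le_trans _ _ (\sum_(M <= m < size s) c m)).
  by apply: ler_sum => m _; rewrite /z normrZ x1 mulr1 gtr0_norm.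
rewrite lerBrDl; apply: le_trans (cD (size s)).
by rewrite -(big_mkord xpredT c) -(big_mkord xpredT c) -(big_cat_nat _ Ms).
Qed.

Lemma norm_column s : `|column s| <= D.
Proof.
by have := norm_column_sub_head (leq0n (size s)); rewrite !big_ord0 !subr0.
Qed.

Variable U : set_system nat.
Context {UU : UltraFilter U}.
Hypotheses (Uoo : \oo `<=` U) (x0 : forall n, weakly_null (x n)).

Local Notation F := (column_filter U).

(** The entries of a tuple are chosen one after the other, and each new term is that
    of a weakly null sequence; by lower semicontinuity none of them can make g drop. *)
Lemma tuple_filter_lsc (g : X -> R) v a L M : subdifferentiable g ->
  L < g v -> tuple_filter U M [set s | L < g (v + a *: column s)].
Proof.
move=> gsub Lg; elim: M => [|M IHM] /=.
  by rewrite /column big_ord0 scaler0 addr0.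
apply: filterS IHM => s Ls; apply: Uoo.
have := weakly_null_lsc (a * c (size s)) (@x0 (size s)) gsub Ls.
by apply: filterS => k; rewrite /= column_rcons scalerDr scalerA addrA.
Qed.

Lemma column_filter_lsc v a L : L < `|v| ->
  \forall s \near F, L < `|v + a *: column s|.
Proof.
move=> Lv; apply: (column_filter_from Uoo (n := 0)) => M _.
apply: (tuple_filter_lsc (g := Num.norm)) => //.
have xD k : `|x 0%N k| <= 1 by rewrite x1.
exact: (iter_norm_subdifferentiable (F := U) xD 0 (fun=> 0)).
Qed.

(** The rows preceding the n-th one are dropped by lower semicontinuity of the limit
    along row n, and the rows following it by lower semicontinuity of the inner
    iterated limit. *)
Lemma column_filter_dominates n :
  lim_dominates F U column (fun k => c n *: x n k).
Proof.
move=> p a v L LU.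
have ZD k : `|c n *: x n k| <= c n by rewrite normrZ x1 mulr1 gtr0_norm.
have sub q b : subdifferentiable (iter_norm U (fun k => c n *: x n k) q b).
  exact: (iter_norm_subdifferentiable ZD).
pose g := iter_norm U (fun k => c n *: x n k) p (fun i => a i.+1).
have gn : tuple_filter U n.+1 [set s | L < g (v + a 0%N *: column s)].
  rewrite /=; apply: filterS (filterI (tuple_filter_size n)
    (tuple_filter_lsc (a 0%N) n (sub p.+1 a) LU)) => s [/= sn Ls].
  apply: filterS (cvgr_gt _ (iter_normS_cvg ZD p a _) _ Ls) => k /=.
  by rewrite column_rcons sn scalerDr addrA.
apply: (column_filter_from Uoo (n := n.+1)) => M nM.
rewrite -(subnKC nM); elim: (M - n.+1)%N => [|j IHj]; first by rewrite addn0.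
rewrite addnS /=; apply: filterS IHj => s Ls; apply: Uoo.
have := weakly_null_lsc (a 0%N * c (size s)) (@x0 (size s)) (sub p _) Ls.
by apply: filterS => k; rewrite /= column_rcons scalerDr scalerA addrA.
Qed.

Lemma iter_norm_scale_seq (y : nat -> X) b p a v :
  iter_norm U (fun k => b *: y k) p a v = iter_norm U y p (fun i => b * a i) v.
Proof.
elim: p a v => //= p IHp a v; congr ulim; apply/funext => k.
by rewrite IHp scalerA mulrC.
Qed.

Lemma iter_norm_column_ge n p a v :
  iter_norm U (x n) p (fun i => c n * a i) v <= iter_norm F column p a v.
Proof.
rewrite -iter_norm_scale_seq; apply: (iter_norm_mono norm_column).
exact: column_filter_dominates.
Qed.

(** The triangle inequality, with the first M rows treated separately and the
    remaining ones estimated by their total weight.  The vectors v_m are the parts of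
    the base point already contributed by each row; the induction produces them. *)
Lemma iter_norm_column_le M p a w (v : nat -> X) :
  iter_norm F column p a (w + \sum_(m < M) c m *: v m) <=
  `|w| + \sum_(m < M) c m * iter_norm U (x m) p a (v m) +
  (D - \sum_(m < M) c m) * \sum_(i < p) `|a i|.
Proof.
elim: p a w v => [|p IHp] a w v /=.
  rewrite big_ord0 mulr0 addr0.
  apply: (le_trans (ler_normD _ _)); rewrite lerD2l.
  apply: (le_trans (ler_norm_sum _ _ _)); apply: ler_sum => m _.
  by rewrite normrZ gtr0_norm.
have xD m k : `|x m k| <= 1 by rewrite x1.
set rho := D - _.
have rhoS : (rho * \sum_(i < p.+1) `|a i|) =
    rho * `|a 0%N| + rho * \sum_(i < p) `|a i.+1|.
  by rewrite big_ord_recl mulrDr.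
apply: (cvg_le_lim (iter_normS_cvg norm_column p a _)
  (g := fun s => `|w| + \sum_(m < M)
     c m * iter_norm U (x m) p (fun i => a i.+1) (v m + a 0%N *: x m (nth 0%N s m))
     + rho * \sum_(i < p.+1) `|a i|)).
  apply: cvgD; last exact: cvg_cst.
  apply: cvgD; first exact: cvg_cst.
  apply: (@cvg_sum_ord _ _ _ _ R M
    (fun m s => c m * iter_norm U (x m) p (fun i => a i.+1)
       (v m + a 0%N *: x m (nth 0%N s m)))
    (fun m => c m * iter_norm U (x m) p.+1 a (v m))) => m _.
  apply: cvgMl_tmp => A /(iter_normS_cvg (xD m) p a (v m)) UA.
  exact: (column_filter_nth Uoo m UA).
apply: filterS (column_filter_size Uoo M) => s /= Ms.
pose r := column s - \sum_(m < M) c m *: x m (nth 0%N s m).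
have -> : w + \sum_(m < M) c m *: v m + a 0%N *: column s =
    (w + a 0%N *: r) + \sum_(m < M) c m *: (v m + a 0%N *: x m (nth 0%N s m)).
  rewrite -addrA -[in RHS]addrA; congr (_ + _).
  rewrite -[column s](subrK (\sum_(m < M) c m *: x m (nth 0%N s m))) -/r.
  rewrite scalerDr addrCA; congr (_ + _).
  rewrite scaler_sumr -big_split; apply: eq_bigr => m _ /=.
  by rewrite scalerDr scalerA mulrC -scalerA.
apply: (le_trans (IHp _ _ (fun m => v m + a 0%N *: x m (nth 0%N s m)))).
rewrite rhoS; have := ler_normD w (a 0%N *: r); rewrite normrZ.
have : `|a 0%N| * `|r| <= `|a 0%N| * rho.
  by rewrite ler_wpM2l//; exact: norm_column_sub_head.
by rewrite -/rho; lra.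
Qed.

End columns.

(** * Choosing a sequence along an ultrafilter *)

Section dependent_choice.

(** Dependent choice where the requirement on the i-th term may depend on all the
    previous ones. *)
Lemma dependent_choice_history (T : Type) (t0 : T)
    (P : nat -> (nat -> T) -> T -> Prop) :
  (forall i h, exists t, P i h t) ->
  (forall i h h' t, (forall j, (j < i)%N -> h j = h' j) -> P i h t -> P i h' t) ->
  exists s, forall i, P i s (s i).
Proof.
move=> Pex Pext.
have /choice[g gP] : forall ih : nat * (nat -> T), exists t, P ih.1 ih.2 t.
  by move=> [i h]; exact: Pex.
pose hist := fix F i : nat -> T := if i is j.+1 then
  fun l => if l == j then g (j, F j) else F j l else fun=> t0.
have histE i j : (j < i)%N -> hist i j = g (j, hist j).
  elim: i => // i IHi; rewrite ltnS leq_eqVlt => /predU1P[->|ji] /=.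
    by rewrite eqxx.
  by rewrite ltn_eqF// IHi.
exists (fun i => g (i, hist i)) => i.
by apply: (Pext i (hist i)) (gP (i, hist i)) => j /histE.
Qed.

End dependent_choice.

Section uniform.
Context {R : realType} {X : normedModType R} {T : Type}.
Variables (F : set_system T) (Y : T -> X).
Context {FU : UltraFilter F}.
Variable D : R.
Hypothesis YD : forall s, `|Y s| <= D.
Implicit Types (a b : nat -> R).

Lemma norm_lin_comb_le n b (w : nat -> X) :
  `|lin_comb n b w| <= \sum_(j < n) `|b j| * `|w j|.
Proof.
apply: (le_trans (ler_norm_sum _ _ _)).
by apply: ler_sum => j _; rewrite normrZ.
Qed.

(** The convergence defining an iterated limit is uniform on bounded coefficients.
    Otherwise bad coefficients could be chosen for F-most s; they converge along F
    (this is where an ultrafilter plays the part of compactness), and by the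
    Lipschitz estimate their limit contradicts pointwise convergence. *)
Lemma iter_norm_uniform n (w : nat -> X) i B e : 0 <= B -> 0 < e ->
  \forall s \near F, forall a b, (forall j, `|a j| <= B) ->
    (forall j, `|b j| <= B) ->
    `|iter_norm F Y n (fun j => a j.+1) (lin_comb i b w + a 0%N *: Y s) -
      iter_norm F Y n.+1 a (lin_comb i b w)| < e.
Proof.
move=> B0 e0; pose good s := forall a b, (forall j, `|a j| <= B) ->
    (forall j, `|b j| <= B) ->
    `|iter_norm F Y n (fun j => a j.+1) (lin_comb i b w + a 0%N *: Y s) -
      iter_norm F Y n.+1 a (lin_comb i b w)| < e.
change (F good).
have [//|bad] := in_ultra_setVsetC good FU.
pose h a b s := iter_norm F Y n (fun j => a j.+1) (lin_comb i b w + a 0%N *: Y s).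
pose l a b := iter_norm F Y n.+1 a (lin_comb i b w).
have /choice[ab abP] : forall s, exists ab : (nat -> R) * (nat -> R),
    [/\ forall j, `|ab.1 j| <= B, forall j, `|ab.2 j| <= B &
     ~ good s -> e <= `|h ab.1 ab.2 s - l ab.1 ab.2|].
  move=> s; have [gs|ngs] := pselect (good s).
    by exists (fun=> 0, fun=> 0); split=> //= j; rewrite normr0.
  apply: contrapT => nex; apply: ngs => a b aB bB.
  rewrite ltNge; apply/negP => H; apply: nex; exists (a, b); split=> //.
pose a s := (ab s).1; pose b s := (ab s).2.
pose a' j := ulim F (fun s => a s j); pose b' j := ulim F (fun s => b s j).
have aB s j : `|a s j| <= B by have [H _ _] := abP s; exact: H.
have bB s j : `|b s j| <= B by have [_ H _] := abP s; exact: H.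
have ac j : (fun s => a s j) @ F --> a' j by apply: ulim_cvg => s; exact: aB.
have bc j : (fun s => b s j) @ F --> b' j by apply: ulim_cvg => s; exact: bB.
pose E s := \sum_(j < i) `|b s j - b' j| * `|w j| +
            D * \sum_(j < n.+1) `|a s j - a' j|.
have dist0 (u : T -> R) r : u @ F --> r -> (fun s => `|u s - r|) @ F --> (0 : R).
  move=> ur; rewrite -(@normr0 _ R) -(subrr r).
  by apply: cvg_norm; apply: cvgB => //; exact: cvg_cst.
have E0 : E @ F --> (0 : R).
  rewrite (_ : 0 = \sum_(j < i) 0 * `|w j| + D * \sum_(j < n.+1) 0); last first.
    by rewrite big1 ?big1 ?mulr0 ?addr0// => j _; rewrite mul0r.
  apply: cvgD.
    apply: (@cvg_sum_ord _ _ _ _ R i (fun j s => `|b s j - b' j| * `|w j|)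
      (fun j => 0 * `|w j|)) => j _.
    by apply: cvgMr_tmp; apply: dist0; exact: bc.
  apply: cvgMl_tmp; apply: (@cvg_sum_ord _ _ _ _ R n.+1
    (fun j s => `|a s j - a' j|) (fun=> 0)) => j _.
  by apply: dist0; exact: ac.
have lE s : `|l (a s) (b s) - l a' b'| <= E s.
  apply: (le_trans (iter_norm_dist YD _ _ _ _ _)); rewrite lerD2r -lin_combB.
  exact: norm_lin_comb_le.
have hE s : `|h (a s) (b s) s - h a' b' s| <= E s.
  apply: (le_trans (iter_norm_dist YD _ _ _ _ _)).
  rewrite /E big_ord_recl mulrDr addrA lerD2r.
  rewrite opprD addrACA -lin_combB -scalerBl.
  apply: (le_trans (ler_normD _ _)); rewrite lerD ?norm_lin_comb_le//.
  by rewrite normrZ mulrC ler_wpM2r.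
have hl : \forall s \near F, `|h a' b' s - l a' b'| < e / 2.
  have hc : h a' b' @ F --> l a' b' by exact: iter_normS_cvg.
  by move/cvgrPdistC_lt : hc; apply; lra.
have E4 : \forall s \near F, `|E s| < e / 4.
  by move/cvgr0Pnorm_lt : E0; apply; lra.
have [s [ngs [hls Es]]] := filter_ex (filterI bad (filterI hl E4)).
have [_ _ /(_ ngs)] := abP s; rewrite -/(a s) -/(b s).
have := hE s; have := lE s; move: hls (le_lt_trans (ler_norm _) Es).
set hs := h (a s) _ _; set h' := h a' _ _; set ls := l (a s) _; set l' := l a' _.
move=> h'l' Es' lsl' hsh'; have := ler_normD (hs - h') (h' - l' + (l' - ls)).
have := ler_normD (h' - l') (l' - ls); rewrite (distrC l' ls).
have -> : hs - h' + (h' - l' + (l' - ls)) = hs - ls by lra.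
by lra.
Qed.

End uniform.

Section selection.
Context {R : realType} {X : normedModType R} {T : Type}.
Variables (F : set_system T) (Y : T -> X).
Context {FU : UltraFilter F}.
Variable D : R.
Hypothesis YD : forall s, `|Y s| <= D.
Hypothesis Ylsc : forall v c L,
  L < `|v| -> \forall s \near F, L < `|v + c *: Y s|.
Implicit Types (a b : nat -> R).

(** The diagonal argument: by uniform convergence, each of the finitely many
    conditions bearing on the i-th term holds for F-most points, so the terms can be
    chosen one after the other.  The sets Q_i leave room for further requirements. *)
Lemma generic_sequence (Q : nat -> set T) (B : R) (delta : nat -> R) : 0 <= B ->
  (forall i, 0 < delta i) -> (forall i, F (Q i)) ->
  exists s : nat -> T, forall i, Q i (s i) /\ forall n, (n <= i)%N ->
    forall a b, (forall j, `|a j| <= B) -> (forall j, `|b j| <= B) ->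
    `|iter_norm F Y n (fun j => a j.+1) (lin_comb i b (Y \o s) + a 0%N *: Y (s i)) -
      iter_norm F Y n.+1 a (lin_comb i b (Y \o s))| < delta i.
Proof.
move=> B0 d0 FQ; have [t0 _] := filter_ex (@filterT _ F _).
pose P i (h : nat -> T) t := Q i t /\ forall n, (n <= i)%N ->
    forall a b, (forall j, `|a j| <= B) -> (forall j, `|b j| <= B) ->
    `|iter_norm F Y n (fun j => a j.+1) (lin_comb i b (Y \o h) + a 0%N *: Y t) -
      iter_norm F Y n.+1 a (lin_comb i b (Y \o h))| < delta i.
apply: (@dependent_choice_history _ t0 P) => [i h|i h h' t hh' [Qt Pt]].
  suff : F (P i h) by move=> /filter_ex.
  apply: filterI; first exact: FQ.
  apply: (@filter_all_lt _ F (fun n t => forall a b, (forall j, `|a j| <= B) ->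
    (forall j, `|b j| <= B) ->
    `|iter_norm F Y n (fun j => a j.+1) (lin_comb i b (Y \o h) + a 0%N *: Y t) -
      iter_norm F Y n.+1 a (lin_comb i b (Y \o h))| < delta i) i.+1) => n _.
  exact: iter_norm_uniform.
split=> // n ni a b aB bB; rewrite (_ : lin_comb i b (Y \o h') =
  lin_comb i b (Y \o h)); first exact: Pt.
by apply: eq_bigr => j _ /=; rewrite hh'.
Qed.

Variables (B eta : R) (y : nat -> X).
Hypotheses (B0 : 0 <= B) (eta0 : 0 < eta).
Let delta i := eta / 2 ^+ i.
Hypothesis yP : forall i n, (n <= i)%N ->
    forall a b, (forall j, `|a j| <= B) -> (forall j, `|b j| <= B) ->
    `|iter_norm F Y n (fun j => a j.+1) (lin_comb i b y + a 0%N *: y i) -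
      iter_norm F Y n.+1 a (lin_comb i b y)| < delta i.

Lemma delta_gt0 i : 0 < delta i.
Proof. by rewrite divr_gt0// exprn_gt0. Qed.

Lemma deltaS i : delta i = delta i.+1 + delta i.+1.
Proof. by rewrite /delta exprS invfM; set r := (2 ^+ i)^-1; rewrite mulrCA; lra. Qed.

Lemma delta_le i j : (i <= j)%N -> delta j <= delta i.
Proof.
move=> ij; rewrite -(subnKC ij); elim: (j - i)%N => [|m IHm]; first by rewrite addn0.
have := delta_gt0 (i + m).+1; have := deltaS (i + m).
by rewrite addnS; lra.
Qed.

(** The limits are replaced one by one, from the outermost to the innermost, by the
    values at k_0 < k_1 < ...; the errors form a geometric series, which is why the
    bound 2 delta_K reproduces itself. *)
Lemma generic_sequence_spreads n K a b (k : nat -> nat) :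
  (forall j, `|a j| <= B) -> (forall j, `|b j| <= B) ->
  (forall i, (i < n)%N -> (K <= k i)%N) ->
  (forall i, (i < n)%N -> (n <= (k i).+1)%N) ->
  (forall i j, (i < j)%N -> (j < n)%N -> (k i < k j)%N) ->
  `| `|lin_comb K b y + \sum_(i < n) a i *: y (k i)| -
    iter_norm F Y n a (lin_comb K b y)| <= delta K + delta K.
Proof.
elim: n K a b k => [|n IHn] K a b k aB bB Kk nk kk.
  rewrite big_ord0 addr0 /= subrr normr0.
  by have := delta_gt0 K; lra.
have Kk0 : (K <= k 0)%N by exact: Kk.
(* The new base point, still a combination of the vectors before (k 0).+1. *)
pose b' j := if j == k 0 then a 0%N else cut K b j.
have cutB j : `|cut K b j| <= B by rewrite /cut; case: ifP; rewrite ?normr0.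
have b'B j : `|b' j| <= B by rewrite /b'; case: eqP.
have vE : lin_comb K b y = lin_comb (k 0) (cut K b) y by rewrite lin_comb_cut.
have v'E : lin_comb (k 0).+1 b' y = lin_comb K b y + a 0%N *: y (k 0).
  rewrite lin_combS vE {2}/b' eqxx; congr (_ + _); apply: eq_lin_comb => j jk.
  by rewrite /b' ltn_eqF.
have := IHn (k 0).+1 (fun j => a j.+1) b' (fun j => k j.+1)
  (fun j => aB j.+1) b'B.
rewrite v'E -deltaS => /(_ _ _ _)/le_trans IH.
have {}IH := IH _ _ _ _ (lexx _).
have := @yP (k 0) n (nk 0%N isT) a (cut K b) aB cutB; rewrite -vE => /ltW.
have {}IH : `| `|lin_comb K b y + a 0%N *: y (k 0) +
      \sum_(i < n) a i.+1 *: y (k i.+1)| - iter_norm F Y n (fun j => a j.+1)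
      (lin_comb K b y + a 0%N *: y (k 0))| <= delta (k 0).
  apply: IH.
  - by move=> i ni; apply: kk.
  - by move=> i ni; apply: ltnW; apply: nk.
  - by move=> i j ij jn; apply: kk.
have := delta_le Kk0; move: IH.
rewrite big_ord_recl addrA !ler_norml => /andP[? ?] ? /andP[? ?].
by apply/andP; split; lra.
Qed.

Variable kappa : R.
Hypotheses (eta4 : eta <= 1 / 4) (kappa0 : 0 < kappa) (B_ge : 4 / kappa <= B).
Hypothesis y_ge : forall i, kappa <= `|y i|.

Lemma delta_le4 i : delta i <= 1 / 4.
Proof.
by have := delta_le (leq0n i); rewrite {2}/delta expr0 divr1 => /le_trans; exact.
Qed.

(** After normalization the coefficients are bounded by 4 / kappa, so that either
    the approximation by iterated limits applies and suppression of the last vector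
    concludes, or the last term is so large that it outweighs the others. *)
Lemma generic_sequence_step n a :
  (forall m, (m <= n)%N -> `|lin_comb m a y| <= 2 * `|lin_comb n a y|) ->
  (1 - delta n) * `|lin_comb n a y| <= `|lin_comb n.+1 a y|.
Proof.
move=> an; have [->|qn0] := eqVneq `|lin_comb n a y| 0.
  by rewrite mulr0.
set q := `|lin_comb n a y| in an qn0 *.
have q0 : 0 < q by rewrite lt0r qn0 normr_ge0.
pose a' j := q^-1 * a j.
have q1 : `|lin_comb n a' y| = 1.
  by rewrite lin_combZ normrZ gtr0_norm ?invr_gt0// mulVf.
suff : 1 - delta n <= `|lin_comb n.+1 a' y|.
  by rewrite lin_combZ normrZ gtr0_norm ?invr_gt0// mulrC ler_pdivlMr.
have a'B j : (j < n)%N -> `|a' j| <= B.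
  move=> jn; have ajy : `|a j| * `|y j| <= 4 * q.
    rewrite -normrZ (_ : a j *: y j = lin_comb j.+1 a y - lin_comb j a y).
      apply: (le_trans (ler_normB _ _)).
      by have := an _ jn; have := an _ (ltnW jn); lra.
    by rewrite lin_combS addrAC subrr add0r.
  have ajk : `|a' j| * kappa <= 4.
    rewrite /a' normrM gtr0_norm ?invr_gt0// -mulrA ler_pdivrMl//.
    rewrite (mulrC q); apply: le_trans ajy.
    by rewrite ler_wpM2l.
  by apply: le_trans B_ge; rewrite ler_pdivlMr.
(* If the last term has norm at least 2, it alone ensures the estimate. *)
have [an2|an2] := leP 2 (`|a' n| * kappa).
  have := lerB_normD (a' n *: y n) (lin_comb n a' y).
  rewrite q1 [X in _ <= `|X|]addrC -lin_combS normrZ.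
  have : `|a' n| * kappa <= `|a' n| * `|y n| by rewrite ler_wpM2l.
  by have := delta_gt0 n; lra.
have a'nB : `|a' n| <= B.
  by apply: le_trans B_ge; rewrite ler_pdivlMr//; lra.
have cutB j : `|cut n a' j| <= B.
  by rewrite /cut; case: ifP => [/a'B//|]; rewrite normr0.
have /= := yP (leq0n n) (fun=> a'nB) cutB.
have : `|lin_comb n (cut n a') y| <=
    iter_norm F Y 1 (fun=> a' n) (lin_comb n (cut n a') y).
  exact: (iter_norm_ge_norm YD Ylsc).
rewrite lin_comb_cut// q1 -lin_combS /= ltr_norml => ? /andP[].
lra.
Qed.

Lemma generic_sequence_projections m n a : (m <= n)%N ->
  `|lin_comb m a y| <= 2 * `|lin_comb n a y|.
Proof.
(* The factor 1 / 2 + 2 delta_n decreases to 1 / 2 in such a way that one step,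
   which loses the factor 1 - delta_n, is absorbed. *)
have weaken l k : (1 / 2 + 2 * delta k) * `|lin_comb l a y| <= `|lin_comb k a y| ->
    `|lin_comb l a y| <= 2 * `|lin_comb k a y|.
  have : 0 <= 2 * delta k * `|lin_comb l a y|.
    by rewrite mulr_ge0// mulr_ge0//; exact/ltW/delta_gt0.
  by rewrite mulrDl; lra.
move=> mn; apply: (weaken m n _); elim: n m mn => [|n IHn] m.
  by rewrite leqn0 => /eqP ->; rewrite /lin_comb !big_ord0 normr0 mulr0.
rewrite leq_eqVlt => /predU1P[->|].
  by rewrite ler_piMl//; have := delta_le4 n.+1; lra.
rewrite ltnS => mn; have := delta_le4 n; have := delta_gt0 n => d0 d4.
have step := @generic_sequence_step n a (fun l ln => weaken _ _ (IHn l ln)).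
apply: (le_trans _ step).
have dS : 1 / 2 + 2 * delta n.+1 <= (1 - delta n) * (1 / 2 + 2 * delta n).
  have := deltaS n; have : 0 <= delta n * (1 / 4 - delta n) by rewrite mulr_ge0//; lra.
  by rewrite mulrBl mul1r mulrBr mulrDr; lra.
apply: (@le_trans _ _ ((1 - delta n) * (1 / 2 + 2 * delta n) * `|lin_comb m a y|)).
  by rewrite ler_wpM2r.
by rewrite -mulrA ler_wpM2l ?IHn//; lra.
Qed.

End selection.

(** * Spreading models and the unit vector basis of ell_1 *)

Section ell1_basis_norm.
Context {R : realType}.

Lemma ell1_lin_combE n (a : nat -> R) j :
  lin_comb n a (@ell1_basis R) j = cut n a j.
Proof.
elim: n => [|n IHn]; first by rewrite /lin_comb big_ord0.
have -> : lin_comb n.+1 a (@ell1_basis R) j =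
    lin_comb n a (@ell1_basis R) j + a n * (j == n)%:R by rewrite lin_combS.
rewrite IHn /cut ltnS; case: (ltngtP j n) => [_|_|->].
- by rewrite mulr0 addr0.
- by rewrite mulr0 addr0.
- by rewrite mulr1 add0r.
Qed.

Lemma norm_ell1_lin_comb n (a : nat -> R) :
  `|lin_comb n a (@ell1_basis R)| = \sum_(i < n) `|a i|.
Proof.
apply: (@cvg_lim _ (@Rhausdorff R)).
apply: cvg_near_cst; exists n => // m /= nm.
rewrite /series/= (big_cat_nat _ nm)//= [X in _ + X]big_nat_cond.
rewrite [X in _ + X]big1 ?addr0.
  by rewrite big_mkord; apply: eq_bigr => i _; rewrite ell1_lin_combE cut_lt.
by move=> i /andP[/andP[ni _] _]; rewrite ell1_lin_combE cut_ge// normr0.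
Qed.

End ell1_basis_norm.

Section iter_norm_squeeze.
Context {R : realType} {X : normedModType R}.
Variables (U : set_system nat) (x : nat -> X).
Context {UU : UltraFilter U}.
Hypotheses (Uoo : \oo `<=` U) (x1 : normalized x).

(** Iterated limits only see strictly increasing choices of indices beyond K. *)
Lemma iter_norm_squeeze n a v K L e :
  (forall k : nat -> nat, {homo k : i j / (i < j)%N} -> (K <= k 0)%N ->
    `| `|v + lin_comb n a (x \o k)| - L| <= e) ->
  `|iter_norm U x n a v - L| <= e.
Proof.
elim: n a v K => [|n IHn] a v K H.
  have := H (addn K); rewrite /lin_comb big_ord0 addr0; apply; last exact: leq_addr.
  by move=> i j; rewrite ltn_add2l.
have xD k : `|x k| <= 1 by rewrite x1.
apply: (@cvgr_to_le _ U _ _ (fun k =>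
    `|iter_norm U x n (fun i => a i.+1) (v + a 0%N *: x k) - L|)).
  apply: cvg_norm; apply: cvgB; last exact: cvg_cst.
  exact: (iter_normS_cvg xD).
apply: (filterS _ (Uoo (nbhs_infty_ge K))) => k0 /= Kk0.
apply: (IHn _ _ k0.+1) => k kk k0k.
pose k' i := if i is j.+1 then k j else k0.
have := H k'; rewrite /lin_comb big_ord_recl addrA; apply=> // -[|i] [|j]//= ij.
  by apply: (leq_trans k0k); case: j {ij} => // j; apply/ltnW/kk.
exact: kk.
Qed.

End iter_norm_squeeze.

Section spreading_model.
Context {R : realType} {X Y : normedModType R}.
Variables (x : nat -> X) (xt : nat -> Y).
Hypotheses (xxt : has_spreading_model x xt) (x1 : normalized x).

Lemma homo_ltn_ge (k : nat -> nat) i :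
  {homo k : i j / (i < j)%N} -> (k 0 <= k i)%N.
Proof. by move=> kk; case: i => // i; apply/ltnW/kk. Qed.

(** The defining estimate of spreading models freed from its normalization: the
    coefficients are rescaled into [-1, 1], and padded with zeros so that a small
    error is available for a combination of fixed length. *)
Lemma spreading_model_cvg n a e : 0 < e -> exists N, forall k : nat -> nat,
  {homo k : i j / (i < j)%N} -> (N <= k 0)%N ->
  `| `|lin_comb n a (x \o k)| - `|lin_comb n a xt| | <= e.
Proof.
move=> e0; have [_ _ [eps [epsd eps0 H]]] := xxt.
pose A := 1 + \sum_(i < n) `|a i|.
have A0 : 0 < A by rewrite ltr_pwDl// sumr_ge0.
have eA : 0 < e / A by rewrite divr_gt0.
move/cvgr0Pnorm_lt : eps0 => /(_ _ eA)[N0 _ /(_ N0 (leqnn _)) /= epsN].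
pose N := maxn n N0; exists N => k kk Nk.
pose b i := A^-1 * cut n a i.
have b1 (i : 'I_N) : -1 <= b i <= 1.
  rewrite -ler_norml normrM normfV (gtr0_norm A0) ler_pdivrMl// mulr1.
  rewrite /cut; case: ltnP => [ni|_]; last by rewrite normr0 ltW.
  rewrite /A (bigD1 (Ordinal ni))//=.
  have : 0 <= \sum_(i0 < n | i0 != Ordinal ni) `|a i0| by exact: sumr_ge0.
  lra.
have bE (Z : normedModType R) (z : nat -> Z) :
    \sum_(i < N) b i *: z i = A^-1 *: lin_comb n a z.
  rewrite -[LHS]/(lin_comb N b z) /b lin_combZ lin_comb_cut//.
  by rewrite leq_max leqnn.
have := H N b (fun i => k i) b1.
rewrite (bE _ (x \o k)) bE !normrZ gtr0_norm ?invr_gt0// -mulrBr normrM.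
rewrite gtr0_norm ?invr_gt0// => HN.
have {}HN : A^-1 * `| `|lin_comb n a (x \o k)| - `|lin_comb n a xt| | < eps N.
  apply: HN => [i|i j]; last exact: kk.
  by apply: leqW; apply: leq_trans Nk _; exact: homo_ltn_ge.
have : eps N < e / A.
  apply: le_lt_trans (epsd _ _ (leq_maxr n N0)) _.
  exact: le_lt_trans (ler_norm _) epsN.
move=> /(lt_trans HN); rewrite mulrC ltr_pM2r ?invr_gt0//.
exact: ltW.
Qed.

Lemma eq_of_dist_le (r s : R) :
  (forall e, 0 < e -> `|r - s| <= e) -> r = s.
Proof.
move=> H; apply/eqP; rewrite -subr_eq0 -normr_le0.
by apply/ler_addgt0Pr => e e0; rewrite add0r; exact: H.
Qed.

Lemma iter_norm_spreading_model (U : set_system nat) {UU : UltraFilter U} n a :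
  \oo `<=` U -> iter_norm U x n a 0 = `|lin_comb n a xt|.
Proof.
move=> Uoo; apply: eq_of_dist_le => e e0.
have [N HN] := spreading_model_cvg n a e0.
by apply: (iter_norm_squeeze Uoo x1 (K := N)) => k kk Nk; rewrite add0r; exact: HN.
Qed.

(** Spreading invariance: both sides approximate the same combinations of the
    x_k far enough, as a subsequence of indices far out is again far out. *)
Lemma spreading_model_subsequence n a (k : nat -> nat) :
  {homo k : i j / (i < j)%N} ->
  `|lin_comb n a (xt \o k)| = `|lin_comb n a xt|.
Proof.
move=> kk.
(* The coefficients a placed at the positions k. *)
pose w p := \sum_(i < n) (k i == p)%:R * a i.
have wE (Z : normedModType R) (z : nat -> Z) :
    lin_comb (k n) w z = lin_comb n a (z \o k).
  rewrite /lin_comb /w; under eq_bigr do rewrite scaler_suml.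
  rewrite exchange_big/=; apply: eq_bigr => i _.
  rewrite (bigD1 (Ordinal (kk _ _ (ltn_ord i))))//= eqxx mul1r big1 ?addr0//.
  by move=> j; rewrite -val_eqE/= eq_sym => /negbTE ->; rewrite mul0r scale0r.
apply: eq_of_dist_le => e e0; have e20 : 0 < e / 2 by lra.
have [N1 HN1] := spreading_model_cvg n a e20.
have [N2 HN2] := spreading_model_cvg (k n) w e20.
pose h := addn (maxn N1 N2).
have hh : {homo h : i j / (i < j)%N} by move=> i j; rewrite ltn_add2l.
have := HN2 h hh (leq_trans (leq_maxr _ _) (leq_addr _ _)).
have := HN1 (h \o k) (fun i j ij => hh _ _ (kk i j ij))
  (leq_trans (leq_maxl _ _) (leq_addr _ _)).
rewrite !wE -/(x \o (h \o k)) -[(x \o h) \o k]/(x \o (h \o k)).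
set r := `|lin_comb n a (xt \o k)|; set s := `|lin_comb n a xt|.
set t := `|lin_comb n a _|.
move=> ts tr; have := ler_normD (r - t) (t - s).
by rewrite subrKA (distrC r t); lra.
Qed.

Lemma norm_spreading_model i : `|xt i| = 1.
Proof.
have addn_homo m : {homo addn m : j l / (j < l)%N}.
  by move=> j l; rewrite ltn_add2l.
have := spreading_model_subsequence 1 (fun=> 1) (addn_homo i).
rewrite /lin_comb !big_ord1 !scale1r /= addn0 => ->.
apply: eq_of_dist_le => e e0; have [N HN] := spreading_model_cvg 1 (fun=> 1) e0.
have := HN (addn N) (addn_homo N) (leq_addr _ _).
by rewrite /lin_comb !big_ord1 !scale1r /= addn0 x1 distrC.
Qed.

Lemma norm_lin_comb_spreading_model n a :
  `|lin_comb n a xt| <= \sum_(i < n) `|a i|.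
Proof.
apply: (le_trans (norm_lin_comb_le _ _ _)).
by apply: ler_sum => i _; rewrite norm_spreading_model mulr1.
Qed.

(** The norm is always at most the ell_1 norm, so failing to be equivalent to the
    basis of ell_1 can only mean that the reverse estimate fails. *)
Lemma not_ell1_small_combination e : 0 < e ->
  ~ equivalent xt (@ell1_basis R) ->
  exists n a, `|lin_comb n a xt| < e * \sum_(i < n) `|a i|.
Proof.
move=> e0 nell1; apply: contrapT => H; apply: nell1; split; last first.
  exists 1 => // n a; rewrite mul1r norm_ell1_lin_comb.
  exact: norm_lin_comb_spreading_model.
exists (1 + e^-1) => [|n a]; first by rewrite lerDl invr_ge0 ltW.
rewrite norm_ell1_lin_comb; have := normr_ge0 (lin_comb n a xt).
have : e * \sum_(i < n) `|a i| <= `|lin_comb n a xt|.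
  by rewrite leNgt; apply/negP => ?; apply: H; exists n, a.
by rewrite mulrC -ler_pdivlMr// mulrDl mul1r (mulrC e^-1); lra.
Qed.

End spreading_model.

Section product_coefficients.
Context {R : realType}.

Lemma sum_ord_mul (V : nmodType) n p (g : nat -> V) :
  \sum_(l < n * p) g l = \sum_(i < n) \sum_(j < p) g (i * p + j)%N.
Proof.
elim: n => [|n IHn]; first by rewrite !big_ord0.
by rewrite mulSnr big_split_ord big_ord_recr /= IHn.
Qed.

(** The tensor product of a and b, linearized by Euclidean division by p. *)
Definition tensor p (a b : nat -> R) l := a (l %/ p)%N * b (l %% p)%N.

Lemma tensorE p a b i j : (j < p)%N -> tensor p a b (i * p + j) = a i * b j.
Proof.
move=> jp; rewrite /tensor divnMDl ?divn_small ?addn0 ?modnMDl ?modn_small//.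
exact: leq_ltn_trans jp.
Qed.

Lemma lin_comb_tensorl (V : normedModType R) n p a b (z : nat -> V) :
  lin_comb (n * p) (tensor p a b) z =
  \sum_(i < n) a i *: lin_comb p b (z \o addn (i * p)).
Proof.
rewrite /lin_comb (sum_ord_mul n p (fun l => tensor p a b l *: z l)).
apply: eq_bigr => i _; rewrite scaler_sumr; apply: eq_bigr => j _.
by rewrite tensorE// scalerA.
Qed.

Lemma lin_comb_tensorr (V : normedModType R) n p a b (z : nat -> V) :
  lin_comb (n * p) (tensor p a b) z =
  \sum_(j < p) b j *: lin_comb n a (z \o (fun i => i * p + j)%N).
Proof.
rewrite /lin_comb (sum_ord_mul n p (fun l => tensor p a b l *: z l)) exchange_big.
apply: eq_bigr => j _; rewrite scaler_sumr; apply: eq_bigr => i _.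
by rewrite tensorE// scalerA mulrC.
Qed.

Lemma sum_norm_tensor n p a b :
  \sum_(l < n * p) `|tensor p a b l| =
  (\sum_(i < n) `|a i|) * \sum_(j < p) `|b j|.
Proof.
rewrite (sum_ord_mul n p (fun l => `|tensor p a b l|)) mulr_suml.
apply: eq_bigr => i _; rewrite mulr_sumr; apply: eq_bigr => j _.
by rewrite tensorE// normrM.
Qed.

(** By spreading invariance the tensor product of a and b inherits the smallness of
    each factor: for a norm small on a (resp. b), sum first over the blocks where the
    coefficients are proportional to a (resp. b). *)
Lemma common_small_combination (X : normedModType R) (Y : nat -> normedModType R)
    (x : nat -> nat -> X) (xt : forall m, nat -> Y m) M (e : R) : 0 < e ->
  (forall m, has_spreading_model (x m) (xt m)) ->
  (forall m, normalized (x m)) ->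
  (forall m, ~ equivalent (xt m) (@ell1_basis R)) ->
  exists n (a : nat -> R), 0 < \sum_(i < n) `|a i| /\
    forall m, (m < M)%N ->
      `|lin_comb n a (xt m)| <= e * \sum_(i < n) `|a i|.
Proof.
move=> e0 sm x1 nell1; elim: M => [|M [n [a [a0 aM]]]].
  by exists 1%N, (fun=> 1); rewrite big_ord1 normr1.
have [p [b bM]] := not_ell1_small_combination (sm M) (x1 M) e0 (@nell1 M).
have b0 : 0 < \sum_(i < p) `|b i|.
  by rewrite -(pmulr_rgt0 _ e0); exact: le_lt_trans bM.
have p0 : (0 < p)%N.
  by rewrite lt0n; apply/eqP => p0; move: b0; rewrite p0 big_ord0 ltxx.
exists (n * p)%N, (tensor p a b); rewrite sum_norm_tensor; split.
  by rewrite mulr_gt0.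
move=> m; rewrite ltnS leq_eqVlt => /predU1P[->|mM].
  rewrite lin_comb_tensorl; apply: (le_trans (ler_norm_sum _ _ _)).
  rewrite mulrCA mulr_suml; apply: ler_sum => i _.
  rewrite normrZ ler_wpM2l// (spreading_model_subsequence (sm M)) ?ltW//.
  by move=> j l; rewrite ltn_add2l.
rewrite lin_comb_tensorr; apply: (le_trans (ler_norm_sum _ _ _)).
rewrite mulrA mulrC mulr_suml; apply: ler_sum => j _.
rewrite normrZ ler_wpM2l// (spreading_model_subsequence (sm m)) ?aM//.
by move=> i l; rewrite ltn_add2r ltn_pmul2r.
Qed.

End product_coefficients.

(** * Assembling the sequence and its spreading model *)

Section weakly_null_columns.
Context {R : realType} {X : normedModType R}.
Variables (c : nat -> R) (x : nat -> nat -> X) (D : R).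
Hypotheses (c0 : forall n, 0 < c n) (cD : forall n, \sum_(m < n) c m <= D).
Hypothesis c_cvg : (fun n => \sum_(m < n) c m) @ \oo --> D.
Hypotheses (x1 : forall n, normalized (x n)) (x0 : forall n, weakly_null (x n)).

Lemma summable_tail_lt e : 0 < e -> exists M, D - \sum_(m < M) c m < e.
Proof.
move=> e0; move/cvgrPdist_lt : c_cvg => /(_ e e0)[M _ /(_ M (leqnn M))/= H].
by exists M; exact: le_lt_trans (ler_norm _) H.
Qed.

(** On the first M rows a functional tends to 0 since the indices tend to infinity,
    and the weights of the other rows are small. *)
Lemma columns_weakly_null (s : nat -> seq nat) :
  (forall i, (i <= size (s i))%N) ->
  (forall i m, (m < i)%N -> (i <= nth 0 (s i) m)%N) ->
  weakly_null (fun i => column c x (s i)).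
Proof.
move=> s_size s_nth f fc.
have [K K0 fK] : exists2 K, 0 < K & forall u, `|f u : R| <= K * `|u|.
  have /linear_boundedP/pinfty_ex_gt0[K K0 fK] := continuous_linear_bounded 0 (fc 0).
  by exists K.
apply/cvgr0Pnorm_lt => e e0.
have [M HM] : exists M, D - \sum_(m < M) c m < e / 2 / K.
  by apply: summable_tail_lt; rewrite !divr_gt0.
pose h m i : R := c m * (f (x m (nth 0%N (s i) m)) : R).
have h0 : (fun i => \sum_(m < M) h m i) @ \oo --> (0 : R).
  have S0 : \sum_(m < M) c m * 0 = 0 by apply: big1 => m _; rewrite mulr0.
  rewrite -[X in _ --> X]S0.
  apply: (@cvg_sum_ord _ _ \oo _ R M h (fun m => c m * 0)) => m _.
  apply: cvgMl_tmp.
  have nth_oo : (fun i => nth 0%N (s i) m) @ \oo --> \oo.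
    move=> A [N _ NA]; exists (maxn N m.+1) => // i /=.
    by rewrite geq_max => /andP[Ni mi]; apply: NA; exact: leq_trans (s_nth _ _ mi).
  exact: (cvg_comp _ _ nth_oo (@x0 m f fc)).
have e20 : 0 < e / 2 by lra.
move/cvgr0Pnorm_lt : h0 => /(_ _ e20) h0.
apply: filterS (filterI h0 (nbhs_infty_ge M)) => i [hi /= Mi].
set z := \sum_(m < M) c m *: x m (nth 0%N (s i) m).
have -> : f (column c x (s i)) = f z + f (column c x (s i) - z).
  by rewrite -linearD addrC subrK.
apply: le_lt_trans (ler_normD _ _) _.
have fz : f z = \sum_(m < M) h m i.
  by rewrite linear_sum; apply: eq_bigr => m _; rewrite linearZ.
have : `|f (column c x (s i) - z) : R| < e / 2.
  apply: le_lt_trans (fK _) _; rewrite mulrC -ltr_pdivlMr//.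
  apply: le_lt_trans HM; apply: norm_column_sub_head => //.
  exact: leq_trans Mi (s_size i).
by rewrite fz; lra.
Qed.

End weakly_null_columns.

Section sequence_with_prescribed_norm.
Context {R : realType}.
Variables (N : nat -> (nat -> R) -> R) (D : R).
Implicit Types (a b : nat -> R).
Hypothesis N_opp : forall n a, N n (fun i => - a i) = N n a.
Hypothesis N_le : forall n a, N n a <= D * \sum_(i < n) `|a i|.
Hypothesis N_dual : forall n a, exists t : nat -> R,
  \sum_(i < n) a i * t i = N n a /\
  forall m b, \sum_(i < m) b i * t i <= N m b.

Let dual_ball (t : nat -> R) := forall m b, \sum_(i < m) b i * t i <= N m b.

Lemma sum_delta n i e (t : nat -> R) : (i < n)%N ->
  \sum_(j < n) (if j == i :> nat then e else 0) * t j = e * t i.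
Proof.
move=> ni; rewrite (bigD1 (Ordinal ni))//= eqxx big1 ?addr0// => j.
by rewrite -val_eqE/= => /negbTE ->; rewrite mul0r.
Qed.

Lemma dual_ball_le t i : dual_ball t -> `|t i| <= D.
Proof.
move=> tN; have H e : `|e| = 1 -> e * t i <= D.
  move=> e1; rewrite -(@sum_delta i.+1)//.
  apply: le_trans (tN i.+1 (fun j => if j == i then e else 0)) _.
  apply: le_trans (N_le _ _) _; rewrite (bigD1 ord_max)//= eqxx e1.
  rewrite big1 ?addr0 ?mulr1// => j.
  by rewrite -val_eqE/= => /negbTE ->; rewrite normr0.
have := H 1; have := H (-1); rewrite normrN normr1 => /(_ erefl) + /(_ erefl).
by rewrite ler_norml; lra.
Qed.

Lemma dual_ball_norm t n a : dual_ball t -> `|\sum_(i < n) a i * t i| <= N n a.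
Proof.
move=> tN; rewrite ler_norml tN andbT lerNl -N_opp.
apply: le_trans (tN n (fun i => - a i)).
by under [leRHS]eq_bigr do rewrite mulNr; rewrite sumrN.
Qed.

Let coordinate i : (nat -> R) -> R := fun t => if `[< dual_ball t >] then t i else 0.

Lemma coordinate_bounded i : coordinate i \in bounded_fun_pred.
Proof.
apply/bounded_fun_predP; exists D => t; rewrite /coordinate.
case: asboolP => [|_]; first exact: dual_ball_le.
have [t' [_ /dual_ball_le H]] := N_dual 0 (fun=> 0).
by rewrite normr0; exact: le_trans (normr_ge0 _) (H 0%N).
Qed.

Definition coordinate_linfty i : linfty R (nat -> R) := Linfty (coordinate_bounded i).

Lemma lin_comb_coordinate n a t : lin_comb n a coordinate_linfty t =
  if `[< dual_ball t >] then \sum_(i < n) a i * t i else 0.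
Proof.
elim: n => [|n IHn].
  by rewrite /lin_comb !big_ord0; case: ifP.
have -> : lin_comb n.+1 a coordinate_linfty t =
    lin_comb n a coordinate_linfty t + a n * coordinate n t by rewrite lin_combS.
rewrite IHn /coordinate; case: ifP => _; last by rewrite mulr0 addr0.
by rewrite big_ord_recr.
Qed.

(** Each functional of the dual ball gives at most N by evenness, and a norming one
    attains it. *)
Lemma norm_lin_comb_coordinate n a : `|lin_comb n a coordinate_linfty| = N n a.
Proof.
apply/eqP; rewrite eq_le; have [t [tN tb]] := N_dual n a; apply/andP; split.
  apply: linfty_norm_le => t'; rewrite lin_comb_coordinate.
  case: asboolP => [|_]; first exact: dual_ball_norm.
  by rewrite normr0; apply: le_trans (dual_ball_norm n a tb).
apply: le_trans (linfty_norm_ge _ t); rewrite lin_comb_coordinate asboolT//.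
by rewrite tN ler_norm.
Qed.

End sequence_with_prescribed_norm.

(** The columns chosen generically, and the two-sided estimate for their spreading
    model from which all the domination properties follow. *)
Lemma weighted_columns_spreading_model (R : realType) (X : completeNormedModType R)
    (c : nat -> R) (D : R) (x : nat -> nat -> X)
    (E : nat -> completeNormedModType R) (xt : forall n : nat, nat -> E n) :
  (forall n, 0 < c n) -> (forall n, \sum_(m < n) c m <= D) ->
  (fun n => \sum_(m < n) c m) @ \oo --> D ->
  (forall n, normalized (x n)) -> (forall n, weakly_null (x n)) ->
  (forall n, has_spreading_model (x n) (xt n)) ->
  exists (y : nat -> X) (F : completeNormedModType R) (yt : nat -> F),
    [/\ seminormalized y, weakly_null y, basic_sequence y
      & has_spreading_model y yt] /\
    (forall m n a, c m * `|lin_comb n a (xt m)| <= `|lin_comb n a yt|) /\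
    (forall M n a, `|lin_comb n a yt| <=
      \sum_(m < M) c m * `|lin_comb n a (xt m)| +
      (D - \sum_(m < M) c m) * \sum_(i < n) `|a i|).
Proof.
move=> c0 cD c_cvg x1 x0 sm.
have [U [UU Uoo]] := ultraFilterLemma eventually_filter.
pose F := column_filter U; pose Y := column c x.
have YD : forall s, `|Y s| <= D by apply: norm_column.
have Ylsc : forall v a L, L < `|v| -> \forall s \near F, L < `|v + a *: Y s|.
  exact: column_filter_lsc.
pose N n a := iter_norm F Y n a 0.
have N_ge m n a : c m * `|lin_comb n a (xt m)| <= N n a.
  rewrite -(gtr0_norm (c0 m)) -normrZ -lin_combZ.
  rewrite -(iter_norm_spreading_model (sm m) (x1 m) _ _ Uoo).
  exact: iter_norm_column_ge.
have N_ub M n a : N n a <= \sum_(m < M) c m * `|lin_comb n a (xt m)| +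
      (D - \sum_(m < M) c m) * \sum_(i < n) `|a i|.
  have := iter_norm_column_le c0 cD x1 Uoo M n a 0 (fun=> 0).
  rewrite big1 ?addr0 => [|i _]; last by rewrite scaler0.
  rewrite normr0 add0r; under [X in _ <= X + _]eq_bigr => m _ do
    rewrite (iter_norm_spreading_model (sm m) (x1 m) _ _ Uoo).
  exact.
(* The columns have iterated limit at least c_0, and an error of at most half of
   it keeps their norms above kappa. *)
pose kappa := c 0%N / 2; pose eta := Num.min (1 / 4) kappa.
have kappa0 : 0 < kappa by rewrite divr_gt0.
have eta0 : 0 < eta by rewrite lt_min kappa0 andbT; lra.
have eta4 : eta <= 1 / 4 by rewrite ge_min lexx.
pose B := 1 + 4 / kappa.
have B1 : 1 <= B by rewrite lerDl divr_ge0// ltW.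
have B0 : 0 <= B by exact: le_trans B1.
have B_ge : 4 / kappa <= B by rewrite lerDr.
have d0 i : 0 < eta / 2 ^+ i by rewrite divr_gt0// exprn_gt0.
pose Q i (s : seq nat) := (i <= size s)%N /\
  forall m, (m < i)%N -> (i <= nth 0 s m)%N.
have FQ i : F (Q i).
  apply: filterI; first exact: column_filter_size.
  apply: filter_all_lt => m _.
  apply: (column_filter_nth Uoo m (P := [set k | (i <= k)%N])).
  by apply: Uoo; exact: nbhs_infty_ge.
have [s sP] := generic_sequence YD B0 d0 FQ.
pose y i := Y (s i).
have yP i n : (n <= i)%N -> forall a b : nat -> R, (forall j, `|a j| <= B) ->
    (forall j, `|b j| <= B) ->
    `|iter_norm F Y n (fun j => a j.+1) (lin_comb i b y + a 0%N *: y i) -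
      iter_norm F Y n.+1 a (lin_comb i b y)| < eta / 2 ^+ i.
  by have [_ H] := sP i; exact: H.
have y_ge i : kappa <= `|y i|.
  have := yP i 0%N isT (fun=> 1) (fun=> 0).
  rewrite normr0 normr1 => /(_ (fun=> B1) (fun=> B0)).
  rewrite (_ : lin_comb i _ y = 0); last by apply: big1 => j _; rewrite scale0r.
  rewrite -/(N 1%N (fun=> 1)) /= add0r scale1r.
  have := N_ge 0%N 1%N (fun=> 1).
  rewrite [lin_comb _ _ _]big_ord1 scale1r (norm_spreading_model (sm 0%N) (x1 0%N)).
  have : eta / 2 ^+ i <= c 0%N / 2.
    rewrite ler_pdivrMr ?exprn_gt0//.
    apply: (@le_trans _ _ kappa); first by rewrite ge_min lexx orbT.
    by rewrite ler_peMr ?(ltW kappa0)// exprn_ege1// ler1n.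
  rewrite mulr1 ltr_norml => ? ? /andP[]; rewrite /kappa in kappa0 *.
  lra.
have y_proj : forall m n a, (m <= n)%N ->
    `|lin_comb m a y| <= 2 * `|lin_comb n a y|.
  by move=> m n a; apply: (generic_sequence_projections YD Ylsc B0 eta0 yP eta4 kappa0).
have y_sn : seminormalized y.
  by exists kappa, D; split=> // i; rewrite y_ge YD.
have N_dual n (a : nat -> R) : exists t : nat -> R, \sum_(i < n) a i * t i = N n a /\
    forall m (b : nat -> R), \sum_(i < m) b i * t i <= N m b.
  have [f [t [lf fN fle]]] := iter_norm_dual YD n a 0.
  (* Functionals are indexed by all coordinates: those beyond n are set to 0, which
     is harmless because suppressing last terms does not increase N. *)
  exists (cut n t); split=> [|m b].
    rewrite /N -fN linear_fun0// add0r; apply: eq_bigr => i _.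
    by rewrite cut_lt.
  have -> : \sum_(i < m) b i * cut n t i = \sum_(i < n) cut m b i * t i.
    rewrite -[LHS](@lin_comb_cut _ R m (maxn m n) b) ?leq_maxl//.
    under [RHS]eq_bigr do rewrite mulrC.
    rewrite -[RHS](@lin_comb_cut _ R n (maxn m n) t) ?leq_maxr//.
    by apply: eq_bigr => i _; exact: mulrC.
  have := fle (cut m b) 0; rewrite linear_fun0// add0r => /le_trans; apply.
  apply: le_trans (iter_norm_le_length YD Ylsc _ _ (leq_maxr m n)) _.
  rewrite (@iter_norm_pad _ _ _ _ _ _ m) ?leq_maxl//; last by move=> i; exact: cut_ge.
  rewrite (@eq_iter_norm _ _ _ _ _ m (cut m b) b) => [|i]; last exact: cut_lt.
  exact: lexx.
have N_opp n (a : nat -> R) : N n (fun i => - a i) = N n a.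
  by rewrite /N -[X in iter_norm _ _ _ _ X = _]oppr0 iter_normN.
have N_le n (a : nat -> R) : N n a <= D * \sum_(i < n) `|a i|.
  apply: (le_trans (ler_norm _)); apply: (le_trans (iter_norm_bound YD _ _ _)).
  by rewrite normr0 add0r.
pose yt := coordinate_linfty N_le N_dual.
have ytN n a : `|lin_comb n a yt| = N n a by exact: norm_lin_comb_coordinate.
have yt_basic : basic_sequence yt.
  apply: (@bounded_projections_basic _ _ _ 1) => [i|m n a mn]; last first.
    by rewrite mul1r !ytN; exact: (iter_norm_le_length YD Ylsc).
  have e (Z : normedModType R) (z : nat -> Z) :
      lin_comb i.+1 (fun j => (j == i)%:R) z = z i.
    rewrite lin_combS eqxx scale1r [lin_comb _ _ _]big1 ?add0r// => j _.
    by rewrite ltn_eqF// scale0r.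
  have := N_ge 0%N i.+1 (fun j => (j == i)%:R); rewrite -ytN !e.
  rewrite (norm_spreading_model (sm 0%N) (x1 0%N)) mulr1 -normr_gt0.
  exact: lt_le_trans.
exists y, (linfty R (nat -> R)), yt; split; last split.
- split=> //.
  + apply: (columns_weakly_null c0 cD c_cvg x1 x0) => [i|i m mi].
      by have [[]] := sP i.
    by have [[_ H] _] := sP i; exact: H.
  + apply: (bounded_projections_basic _ y_proj) => i.
    by rewrite -normr_gt0; exact: lt_le_trans (y_ge i).
  + split=> //; exists (fun n => 2 / 2 ^+ n); split.
    * move=> m n mn; rewrite ler_pM2l// lef_pV2 ?posrE ?exprn_gt0//.
      by rewrite ler_eXn2l// ltr1n.
    * rewrite -(mulr0 2); apply: cvgMl_tmp.
      rewrite (_ : (fun n => _) = (fun n => (2^-1 : R) ^+ n)).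
        by apply: cvg_expr; rewrite ger0_norm ?invr_ge0// invf_lt1// ltr1n.
      by apply/funext => n; rewrite exprVn.
    * move=> n a k a1 nk kk.
      (* Finite families are extended by default values beyond n. *)
      pose a' j := oapp a 0 (insub j); pose k' j := oapp k 0%N (insub j).
      have a'E (i : 'I_n) : a' i = a i by rewrite /a' valK.
      have k'E (i : 'I_n) : k' i = k i by rewrite /k' valK.
      have a'B j : `|a' j| <= B.
        rewrite /a'; case: insubP => [i _ _|_] /=; last by rewrite normr0.
        by apply: le_trans B1; rewrite ler_norml.
      have -> : \sum_(i < n) a i *: yt i = lin_comb n a' yt.
        by apply: eq_bigr => i _; rewrite a'E.
      have -> : \sum_(i < n) a i *: y (k i) = \sum_(i < n) a' i *: y (k' i).
        by apply: eq_bigr => i _; rewrite a'E k'E.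
      rewrite ytN; case: n a k a1 nk kk a' k' a'E k'E a'B =>
        [|n] a k a1 nk kk a' k' a'E k'E a'B.
        by rewrite big_ord0 /N /= subrr normr0 divr_gt0// exprn_gt0.
      have nk' i : (i < n.+1)%N -> (n < (k' i).+1)%N.
        by move=> ni; rewrite (k'E (Ordinal ni)); exact: nk.
      have kk' i j : (i < j)%N -> (j < n.+1)%N -> (k' i < k' j)%N.
        move=> ij jn; have ni := ltn_trans ij jn.
        by rewrite (k'E (Ordinal ni)) (k'E (Ordinal jn)); exact: kk.
      have := @generic_sequence_spreads _ _ _ _ _ _ _ _ B0 eta0 yP n.+1 n a' (fun=> 0)
        k' a'B _ nk' nk' kk'.
      rewrite [lin_comb _ _ y]big1 => [|j _]; last by rewrite scale0r.
      rewrite add0r normr0 => /(_ (fun=> B0)) /le_lt_trans; apply.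
      rewrite exprS invfM; set r := (2 ^+ n)^-1.
      have r0 : 0 < r by rewrite invr_gt0 exprn_gt0.
      have etar : eta * r <= 1 / 4 * r by rewrite ler_pM2r.
      lra.
- by move=> m n a; rewrite ytN.
- by move=> M n a; rewrite ytN.
Qed.

Theorem proposition3p2 (R : realType) (X : completeNormedModType R)
    (C : nat -> R) (x : nat -> nat -> X)
    (E : nat -> completeNormedModType R) (xt : forall n : nat, nat -> E n)
    (C_gt0 : forall n, 0 < C n)
    (C_summable : cvgn (series (fun n => (C n)^-1)))
    (x_normalized : forall n, normalized (x n))
    (x_weakly_null : forall n, weakly_null (x n))
    (x_spreading : forall n, has_spreading_model (x n) (xt n)) :
  exists (y : nat -> X) (F : completeNormedModType R) (yt : nat -> F),
    [/\ seminormalized y, weakly_null y, basic_sequence y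
      & has_spreading_model y yt] /\
    (forall n, dominates_with (C n) yt (xt n)) /\
    ((forall n, ~ equivalent (xt n) (@ell1_basis R)) ->
      ~ equivalent yt (@ell1_basis R)) /\
    (forall (Z : completeNormedModType R) (z : nat -> Z),
      basic_sequence z -> uniformly_dominates z xt -> dominates z yt).
Proof.
pose c n := (C n)^-1; pose D := limn (series c).
have c0 n : 0 < c n by rewrite invr_gt0.
have cE n : series c n = \sum_(m < n) c m by rewrite /series/= big_mkord.
have c_cvg : (fun n => \sum_(m < n) c m) @ \oo --> D.
  by under eq_fun do rewrite -cE; exact: C_summable.
have cD n : \sum_(m < n) c m <= D.
  rewrite -cE; apply: nondecreasing_cvgn_le => //.
  by apply: nondecreasing_series => i _ _; exact: ltW.
have D0 : 0 <= D by have := cD 0%N; rewrite big_ord0.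
have [y [F [yt [yP [yt_ge yt_le]]]]] := weighted_columns_spreading_model c0 cD c_cvg
  x_normalized x_weakly_null x_spreading.
exists y, F, yt; split=> //; split; last split.
- by move=> n m a; rewrite -ler_pdivrMl//; exact: yt_ge.
- move=> nell1 [[K K1 yt_ell1] _].
  have K4 : 0 < 1 / (4 * K) by rewrite divr_gt0//; lra.
  have [M HM] := summable_tail_lt c_cvg K4.
  have e0 : 0 < 1 / (4 * K * (D + 1)) by rewrite divr_gt0// mulr_gt0//; lra.
  have [n [a [a0 aM]]] := common_small_combination M e0 x_spreading x_normalized nell1.
  have := yt_ell1 n a; rewrite norm_ell1_lin_comb; apply/negP; rewrite -ltNge.
  set S := \sum_(i < n) `|a i| in a0 aM *.
  rewrite mulrC -ltr_pdivlMr; last lra.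
  apply: (le_lt_trans (yt_le M n a)); rewrite -/S.
  have rhoS : (D - \sum_(m < M) c m) * S <= 1 / (4 * K) * S.
    by rewrite ler_pM2r// ltW.
  have sumS : \sum_(m < M) c m * `|lin_comb n a (xt m)| <= 1 / (4 * K) * S.
    apply: (@le_trans _ _ (D * (1 / (4 * K * (D + 1)) * S))).
      apply: (@le_trans _ _ ((\sum_(m < M) c m) * (1 / (4 * K * (D + 1)) * S))).
        rewrite mulr_suml; apply: ler_sum => m _.
        by rewrite ler_pM2l// aM.
      by rewrite ler_wpM2r// mulr_ge0 ?ltW.
    rewrite mulrA ler_pM2r// !div1r invfM mulrCA ler_piMr ?invr_ge0; [|lra|].
      by move: K4; rewrite div1r invr_gt0 => /ltW.
    by rewrite ler_pdivrMr; lra.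
  have : 1 / (4 * K) * S + 1 / (4 * K) * S < S / K.
    rewrite -mulrDl mulrC ltr_pM2l// !div1r invfM.
    have : 0 < K^-1 by rewrite invr_gt0; lra.
    lra.
  lra.
- move=> Z z _ [K K1 zx]; exists (1 + D * K) => [|n a].
    by rewrite lerDl mulr_ge0//; lra.
  apply: (@le_trans _ _ (D * (K * `|lin_comb n a z|))); last first.
    by rewrite mulrDl mul1r mulrA lerDr.
  have lim : (fun M => D * (K * `|lin_comb n a z|) +
      (D - \sum_(m < M) c m) * \sum_(i < n) `|a i|) @ \oo -->
      D * (K * `|lin_comb n a z|).
    rewrite -[X in _ --> X]addr0; apply: cvgD; first exact: cvg_cst.
    rewrite -[X in _ --> X](mul0r (\sum_(i < n) `|a i|)); apply: cvgMr_tmp.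
    by rewrite -[X in _ --> X](subrr D); apply: cvgB; [exact: cvg_cst|].
  apply: (cvgr_to_ge lim); apply: filterE => M.
  apply: (le_trans (yt_le M n a)); rewrite lerD2r.
  apply: (@le_trans _ _ ((\sum_(m < M) c m) * (K * `|lin_comb n a z|))).
    by rewrite mulr_suml; apply: ler_sum => m _; rewrite ler_pM2l// zx.
  by rewrite ler_wpM2r// mulr_ge0//; lra.
Qed.
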